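(* Let $\mathbb{K}$ be an arbitrary field and let $n \geq p \geq 2$ be integers. Let $S$ be a linear subspace of $\mathrm{M}_{n,p}(\mathbb{K})$ with $\operatorname{codim} S \leq n-2$, and let $N \in \mathrm{M}_{n,p}(\mathbb{K})$ be such that $\operatorname{rk} N < p$. Then there exists $A \in S$ such that every matrix of $A + \mathbb{K} N$ has rank $p$.
   Context: $\mathrm{M}_{n,p}(\mathbb{K})$ denotes the $\mathbb{K}$-vector space of all $n$ by $p$ matrices with entries in $\mathbb{K}$. The codimension of $S$ is taken in $\mathrm{M}_{n,p}(\mathbb{K})$, i.e. $\operatorname{codim} S = np - \dim S$. $A + \mathbb{K}N := \{A + \lambda N : \lambda \in \mathbb{K}\}$. The matrix $N$ is not required to belong to $S$. *)

(* Defs.v *)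
From mathcomp Require Import all_boot all_order all_algebra.

Set Implicit Arguments.
Unset Strict Implicit.
Unset Printing Implicit Defensive.

Definition codimv (K : fieldType) (vT : vectType K) (S : {vspace vT}) : nat :=
  \dim {:vT} - \dim S.

(* Main.v *)
Require Import Defs.
From HB Require Import structures.
From mathcomp Require Import all_boot all_order all_algebra.
From mathcomp Require Import zify.
From Stdlib Require Import Classical_Prop.

(** Let [D] be the annihilator of [S] for the pairing [\tr (B *m A)]: its
    dimension is the codimension of [S], and [A] lies in [S] if and only if
    [\tr (B *m A) = 0] for all [B] in [D].  The proof eats up [D] one vector at a
    time while it builds [A] column by column, in the spirit of triangularization.

    The elementary move is [step].  Fix [x] in the kernel of [N] and decide that
    [A *m x = C].  Then [A + l N] sends [x] to [C] for every [l], so it has full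
    column rank as soon as the map that it induces from the quotient by [x] to the
    quotient by [C] has.  The induced problem has the same form, for the map
    induced by [N].  A constraint [B] survives only if [B *m C] is a multiple
    [b x] of [x] (the others are absorbed by the entries of [A] along [C], which
    the rank condition leaves free), and it then prescribes
    the trace [- b] instead of [0].  This is why the problems considered are
    affine: a constraint is a pair [(B, t)] and asks for [\tr (B *m A) = t].
    Transposing a square problem gives the mirror image of every statement.

    If [N] has corank one, a step with [C] in the image of [N] keeps the corank
    equal to one.  Constraints with [N B N != 0] are removed by generic choices of
    [C] ([solvable_independent]).  Those with [N B N = 0] only involve the first
    column and the last row of [A], which are chosen first, the column by a step
    and the row by a transposed step ([solvable_left_null], [solvable_corank1]).
    Genericity must survive over the field with two elements, so it is always
    phrased as avoiding subspaces of sufficiently small dimension.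

    In general one argues by induction on the size for homogeneous problems.
    Given [x] in the kernel, choose a covector [u] with [u x = 1] and [C] killed
    by all [u B]: the step is then homogeneous, and it loses a constraint unless
    every [B] kills [C] ([linear_step]).  If this fails for all choices, as well as
    for the transposed problem, then [D] is very rigid: all the spaces [D C] with
    [C] outside the image of [N] coincide and contain the kernel of [N], and some
    nonzero vector of the image of [N] is killed by [D].  Two cases remain in
    corank at least two, according to the number of constraints with [N B = 0].
    - If their dimension is at least that of the kernel, a single step that fixes
      [A] on the whole kernel makes all of them disappear at once
      ([degenerate_large_left_null]); a theorem of Flanders on full rank matrices
      supplies the restriction of [A] to the kernel.
    - Otherwise a step with [C] outside the image of [N] loses at least two
      constraints ([degenerate_small_left_null]).  It destroys homogeneity, but
      with one constraint to spare affine problems are solvable too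
      ([solvable_small_left_null]).

    Rectangular matrices are reduced to square ones by deleting rows
    ([rect_step]). *)

Set Implicit Arguments.
Unset Strict Implicit.
Unset Printing Implicit Defensive.
Import GRing.Theory.
Local Open Scope ring_scope.

(** * Linear algebra *)

Section LinearAlgebra.
Variable K : fieldType.

Lemma avoid2 (V : vectType K) (E A B : {vspace V}) :
  ~~ (E <= A)%VS -> ~~ (E <= B)%VS -> exists v, [/\ v \in E, v \notin A & v \notin B].
Proof.
move=> /subvPn [a aE aA] /subvPn [b bE bB].
have [aB|aB] := boolP (a \in B); last by exists a.
have [bA|bA] := boolP (b \in A); last by exists b.
exists (a + b); split; first exact: memvD.
- by apply: contra aA => h; rewrite -(addrK b a) memvB.
- by apply: contra bB => h; rewrite -(addKr a b) addrC memvB.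
Qed.

Lemma full_not_sub (V : vectType K) (A : {vspace V}) :
  (\dim A < \dim {:V})%N -> ~~ (fullv <= A)%VS.
Proof. by apply: contraL => /dimvS; rewrite leqNgt. Qed.

Lemma dim_cV n : \dim {: 'cV[K]_n} = n.
Proof. by rewrite dimvf /dim /= muln1. Qed.

Lemma linfunP (aT rT : vectType K) (f : aT -> rT) :
  linear f -> exists F : 'Hom(aT, rT), F =1 f.
Proof.
move=> lf; pose fl := GRing.isLinear.Build K aT rT _ f lf.
pose g : {linear aT -> rT} := HB.pack f fl.
by exists (linfun g) => x; rewrite lfunE.
Qed.

(** The trace pairing is perfect. *)
Lemma functional_trace a b (h : 'M[K]_(a, b) -> K) : scalar h ->
  exists R : 'M[K]_(b, a), forall M, h M = \tr (R *m M).
Proof.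
move=> lh; pose fl := GRing.isLinear.Build K _ K^o _ h lh.
pose g : {linear 'M[K]_(a, b) -> K^o} := HB.pack h fl.
exists (\matrix_(i, j) h (delta_mx j i)) => M.
rewrite -[h]/(g : _ -> _) [in LHS](matrix_sum_delta M) linear_sum /mxtrace /=.
rewrite [RHS](eq_bigr (fun j => \sum_i h (delta_mx i j) * M i j)); last first.
  by move=> j _; rewrite mxE; apply: eq_bigr => i _; rewrite mxE.
rewrite [RHS]exchange_big; apply: eq_bigr => i _.
rewrite -[LHS]/(g _) linear_sum; apply: eq_bigr => j _.
by rewrite linearZ /= [LHS]mulrC.
Qed.

Lemma factor_functional (V W : vectType K) (D : {vspace V}) (c : 'Hom(V, W))
    (g : 'Hom(V, K^o)) :
  (forall w, w \in D -> c w = 0 -> g w = 0) ->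
  exists h : 'Hom(W, K^o), forall w, w \in D -> h (c w) = g w.
Proof.
move=> H; pose cD := (c \o projv D)%VF.
exists (g \o projv D \o cD^-1)%VF => w wD.
have cw : c w = cD w by rewrite comp_lfunE projv_id.
have : cD (cD^-1%VF (c w)) = c w by rewrite limg_lfunVK // cw memv_img ?memvf.
rewrite !comp_lfunE; set w' := projv D _ => e.
have w'D : w' \in D by rewrite memv_proj.
apply/eqP; rewrite -subr_eq0 -linearB /=; apply/eqP/H; first exact: memvB.
by rewrite linearB /= e subrr.
Qed.


Lemma dim_preim_le (V W : vectType K) (f : 'Hom(V, W)) (U : {vspace W}) :
  (\dim (f @^-1: U) <= \dim (lker f) + \dim U)%N.
Proof.
rewrite -(limg_ker_dim f) leq_add ?dimvS ?capvSr //.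
by apply/subvP => v /memv_imgP [w]; rewrite -memv_preim => h ->.
Qed.

Lemma full_rank_left_inverse n t (C : 'M[K]_(n, t)) : \rank C = t -> exists Cp, Cp *m C = 1%:M.
Proof. by move=> rC; exists (pinvmx C); rewrite mulVpmx // /row_full rC. Qed.

Lemma kernel_basis m n (N : 'M[K]_(m, n)) :
  exists X : 'M[K]_(n, n - \rank N), [/\ \rank X = (n - \rank N)%N, N *m X = 0 &
    forall k (v : 'M[K]_(n, k)), N *m v = 0 -> exists y, v = X *m y].
Proof.
have <- : \rank (kermx N^T) = (n - \rank N)%N by rewrite mxrank_ker mxrank_tr.
have e := eq_row_base (kermx N^T).
exists (row_base (kermx N^T))^T; split.
- by rewrite mxrank_tr e.
- apply: trmx_inj; rewrite trmx_mul trmxK trmx0; apply/sub_kermxP.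
  by rewrite e.
- move=> k v Nv; have : (v^T <= row_base (kermx N^T))%MS.
    by rewrite e; apply/sub_kermxP; rewrite -trmx_mul Nv trmx0.
  by case/submxP => y vE; exists y^T; rewrite -trmx_mul -vE trmxK.
Qed.

Lemma dim_lker_mulmx m n (N : 'M[K]_(m, n)) (F : 'Hom('cV[K]_n, 'cV[K]_m)) :
  (forall z, F z = N *m z) -> \dim (lker F) = (n - \rank N)%N.
Proof.
move=> FE; have [X [rX NX kX]] := kernel_basis N.
have [|G GE] := @linfunP 'cV[K]_(n - \rank N) 'cV[K]_n (fun y => X *m y).
  by move=> a u v; rewrite mulmxDr -scalemxAr.
have -> : lker F = limg G.
  apply/vspaceP => v; rewrite memv_ker FE; apply/eqP/memv_imgP => [/kX [y ->]|[y _ ->]].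
    by exists y; rewrite ?memvf ?GE.
  by rewrite GE mulmxA NX mul0mx.
rewrite limg_dim_eq ?dim_cV // capfv; apply/eqP; rewrite -subv0; apply/subvP => y.
rewrite memv_ker GE => /eqP h; rewrite memv0 (_ : y = 0) //.
by have [Z ZX] := full_rank_left_inverse rX; rewrite -[y]mul1mx -ZX -mulmxA h mulmx0.
Qed.

(** The solution set of a consistent affine system is a translate of a subspace of
    dimension at least [n - \dim D], hence it cannot sit inside the smaller [Y].
    Comparing dimensions instead of counting points makes this valid over the
    field with two elements. *)
Lemma affine_avoid (V : vectType K) n (D : {vspace V}) (G : 'Hom(V, 'rV[K]_n))
    (t : 'Hom(V, K^o)) (Y : {vspace 'cV[K]_n}) :
  (forall w, w \in D -> G w = 0 -> t w = 0) -> (\dim Y + \dim D < n)%N ->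
  exists z, z \notin Y /\ forall w, w \in D -> G w *m z = (t w)%:M.
Proof.
move=> tG dY.
have [h hE] := factor_functional tG.
have [|R RE] := @functional_trace 1 n (fun M => h M).
  by move=> a u v; rewrite linearP.
have solR w : w \in D -> G w *m R = (t w)%:M.
  by move=> wD; rewrite -hE // RE mxtrace_mulC trace_mx11 -mx11_scalar.
have [|H HE] := @linfunP 'cV[K]_n 'cV[K]_(\dim D) (fun z => \col_i (G (vbasis D)`_i *m z) 0 0).
  move=> a u v; apply/colP => i.
  by rewrite mxE mulmxDr -scalemxAr !mxE.
have /subvPn [z0 z0H z0Y] : ~~ (lker H <= Y)%VS.
  apply/negP => /dimvS.
  have := limg_ker_dim H fullv; rewrite capfv dim_cV.
  have := dimvS (subvf (limg H)); rewrite dim_cV.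
  lia.
have {}z0H w : w \in D -> G w *m z0 = 0.
  move=> wD; rewrite (coord_vbasis wD) linear_sum mulmx_suml big1 // => i _.
  rewrite linearZ -scalemxAl [_ *m _]mx11_scalar.
  have := z0H; rewrite memv_ker HE => /eqP /colP /(_ i); rewrite !mxE => ->.
  by rewrite raddf0 scaler0.
have [RY|RY] := boolP (R \in Y); last by exists R.
exists (R + z0); split; first by apply: contra z0Y => h'; rewrite -(addKr R z0) addrC memvB.
by move=> w wD; rewrite mulmxDr solR // z0H // addr0.
Qed.

Lemma separate n (V : {vspace 'cV[K]_n}) b : b \notin V ->
  exists R : 'rV[K]_n, (forall v, v \in V -> R *m v = 0) /\ R *m b = 1%:M.
Proof.
move=> bV; pose q v := v - projv V v.
have /matrix0Pn [i [j qb]] : q b != 0.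
  by apply: contraNneq bV => /eqP; rewrite subr_eq0 => /eqP ->; apply: memv_proj.
rewrite ord1 in qb.
have [|R RE] := @functional_trace n 1 (fun v => q v i 0 / q b i 0).
  move=> a u v; rewrite /q linearP !mxE -[RHS]/(a * (_ * _) + _) mulrA -mulrDl.
  by congr (_ / _); rewrite mulrBr opprD addrACA.
have RE' v : R *m v = (q v i 0 / q b i 0)%:M by rewrite RE trace_mx11 -mx11_scalar.
exists R; split=> [v vV|]; rewrite RE'; last by rewrite divff.
by rewrite /q projv_id // subrr mxE mul0r raddf0.
Qed.

(** Over the field with two elements three hyperplanes can cover the space, so one
    of the three subspaces has to have codimension at least two. *)
Lemma avoid3 n (A B X : {vspace 'cV[K]_n}) :
  (\dim A < n)%N -> (\dim B < n)%N -> (\dim X + 2 <= n)%N ->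
  exists z, [/\ z \notin A, z \notin B & z \notin X].
Proof.
move=> dA dB dX.
have [||v [_ vA vB]] := @avoid2 _ fullv A B; rewrite ?full_not_sub ?dim_cV //.
have [vX|vX] := boolP (v \in X); last by exists v.
(* [v] avoids [A] and [B] but lies in [X]: correct it by a vector [f] outside [X] that
   the functionals [R] and [S] separating [v] from [A] and [B] do not see. *)
have [R [RA Rv]] := separate vA; have [S [SB Sv]] := separate vB.
have [|H HE] := @linfunP 'cV[K]_n 'cV[K]_(1 + 1) (fun z => col_mx R S *m z).
  by move=> a u w; rewrite mulmxDr -scalemxAr.
have HE' z : z \in lker H -> R *m z = 0 /\ S *m z = 0.
  by rewrite memv_ker HE mul_col_mx => /eqP; rewrite -col_mx0 => /eq_col_mx.
have /subvPn [f /HE' [Rf Sf] fX] : ~~ (lker H <= X)%VS.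
  apply/negP => HX; have vH : v \notin lker H.
    by apply/negP => /HE' [/eqP]; rewrite Rv oner_eq0.
  have : (lker H + <[v]> <= X)%VS by rewrite subv_add HX -memvE.
  move/dimvS; rewrite dimv_disjoint_sum; last first.
    apply/eqP; rewrite -subv0; apply/subvP => w; rewrite memv_cap => /andP [wH /vlineP [k wE]].
    rewrite memv0 wE; have [->|k0] := eqVneq k 0; first by rewrite scale0r.
    by case/negP: vH; rewrite -[v](scalerK k0) -wE memvZ.
  rewrite dim_vline; have -> : v != 0 by apply: contraNneq vH => ->; rewrite mem0v.
  have := limg_ker_dim H fullv; rewrite capfv dim_cV.
  have := dimvS (subvf (limg H)); rewrite dim_cV.
  lia.
exists (v + f); split.
- by apply/negP => /RA /eqP; rewrite mulmxDr Rv Rf addr0 oner_eq0.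
- by apply/negP => /SB /eqP; rewrite mulmxDr Sv Sf addr0 oner_eq0.
- by apply: contra fX => h; rewrite -(addKr v f) addrC memvB.
Qed.

(** If [c *m h] is in [M], projecting along [c] kills this nonzero element of [M], so
    that the dimension of [M] drops at least as much as that of the span of the
    column directions; conclude by induction. *)
Lemma rank1_span a b (M : {vspace 'M[K]_(a, b)}) :
  exists2 X : {vspace 'cV[K]_a}, (\dim X <= \dim M)%N &
    forall c h, c *m h \in M -> h != 0 -> c \in X.
Proof.
have [d] := ubnP (\dim M); elim: d => // d IH in M *; rewrite ltnS => dM.
have [[c [h [chM c0 h0]]]|H] :=
    classic (exists (c : 'cV_a) (h : 'rV_b), [/\ c *m h \in M, c != 0 & h != 0]); last first.
  exists 0%VS => [|c h chM h0]; first by rewrite dimv0.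
  by rewrite memv0; apply/negPn/negP => c0; apply: H; exists c, h.
have [u uc] : exists u : 'rV_a, u *m c = 1%:M.
  apply: full_rank_left_inverse; apply/eqP; rewrite eqn_leq rank_leq_col lt0n mxrank_eq0 //.
pose p m (v : 'M_(a, m)) := v - c *m (u *m v).
have p_lin m : linear (@p m).
  move=> k v w; rewrite /p mulmxDr -scalemxAr mulmxDr -scalemxAr scalerBr opprD.
  by rewrite addrACA.
have [F FE] := linfunP (p_lin b); have [G GE] := linfunP (p_lin 1%N).
have dF : (\dim (F @: M) < \dim M)%N.
  rewrite -(limg_ker_dim F M) -[ltnLHS]add0n ltn_add2r lt0n dimv_eq0.
  apply: contraNneq h0 => e; have : c *m h \in (M :&: lker F)%VS.
    rewrite memv_cap chM memv_ker FE /p [u *m _]mulmxA uc mul1mx subrr eqxx //.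
  rewrite e memv0 => /eqP ch0; apply/eqP.
  by rewrite -[h]mul1mx -uc -mulmxA ch0 mulmx0.
have [|X dX XP] := IH (F @: M)%VS; first exact: leq_trans dF dM.
exists (G @^-1: X)%VS => [|c' h' ch' h'0]; last first.
  rewrite -memv_preim GE; apply: (XP _ h') => //.
  by apply/memv_imgP; exists (c' *m h') => //; rewrite FE /p mulmxBl !mulmxA.
have : (\dim (lker G) <= \dim <[c]>%VS)%N.
  apply/dimvS/subvP => v; rewrite memv_ker GE subr_eq0 => /eqP ->.
  by rewrite [u *m v]mx11_scalar mul_mx_scalar memvZ ?memv_line.
rewrite dim_vline c0 /= => dG; apply: leq_trans (dim_preim_le _ _) _.
by apply: leq_trans (leq_add dG dX) _; rewrite add1n.
Qed.

Lemma col_inj_rank n p (A : 'M[K]_(n, p)) :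
  (forall v : 'cV_p, A *m v = 0 -> v = 0) -> \rank A = p.
Proof.
move=> inj; rewrite -mxrank_tr; apply/eqP; apply: inj_row_free => v vA.
by apply: trmx_inj; rewrite trmx0; apply: inj; apply: trmx_inj; rewrite trmx_mul trmxK trmx0.
Qed.

Lemma rank_col_inj n p (A : 'M[K]_(n, p)) m (v : 'M[K]_(p, m)) :
  \rank A = p -> A *m v = 0 -> v = 0.
Proof.
by move=> /full_rank_left_inverse [B BA] Av; rewrite -[v]mul1mx -BA -mulmxA Av mulmx0.
Qed.

(** [C] spans a subspace with complement spanned by [J], and [Cp], [P] are the two
    coordinate maps.  Through [P] and [J], matrices with [m] rows or columns stand
    for maps to or from the quotient by [C]; no block decomposition of [n] is ever
    needed. *)
Record splitting n t m (C : 'M[K]_(n, t)) (Cp : 'M[K]_(t, n))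
    (J : 'M[K]_(n, m)) (P : 'M[K]_(m, n)) : Prop := Splitting {
  splitting_lc : Cp *m C = 1%:M;
  splitting_pc : P *m C = 0;
  splitting_lj : Cp *m J = 0;
  splitting_pj : P *m J = 1%:M;
  splitting_id : C *m Cp + J *m P = 1%:M }.

(** A rank factorization of the idempotent [1 - C *m Cp]. *)
Lemma splitting_exists n t m (C : 'M[K]_(n, t)) (Cp : 'M[K]_(t, n)) :
  n = (t + m)%N -> Cp *m C = 1%:M -> exists J P, @splitting n t m C Cp J P.
Proof.
move=> nE CpC; pose E := 1%:M - C *m Cp.
have EC : E *m C = 0 by rewrite mulmxBl mul1mx -mulmxA CpC mulmx1 subrr.
have CE : Cp *m E = 0 by rewrite mulmxBr mulmx1 mulmxA CpC mul1mx subrr.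
have rF : \rank (C *m Cp) = t.
  apply/eqP; rewrite eqn_leq (leq_trans (mxrankM_maxr _ _)) ?rank_leq_row //=.
  rewrite -[leqLHS](mxrank1 K t); have <- : Cp *m (C *m Cp) *m C = 1%:M.
    by rewrite !mulmxA CpC mul1mx CpC.
  by rewrite (leq_trans (mxrankM_maxl _ _)) // mxrankM_maxr.
have rE : \rank E = m.
  rewrite (_ : m = n - t)%N; last by rewrite nE addKn.
  rewrite -rF -mxrank_ker; apply: eqmx_rank; apply/andP; split.
    by apply/sub_kermxP; rewrite mulmxA EC mul0mx.
  rewrite -[X in (X <= _)%MS]mulmx1 -(subrK (C *m Cp) 1%:M) mulmxDr mulmx_ker addr0.
  exact: submxMl.
have [J [P [JP rJ rP]]] : exists (J : 'M_(n, m)) (P : 'M_(m, n)),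
    [/\ J *m P = E, \rank J = m & row_free P].
  move: (col_base E) (row_base E) (mulmx_base E) (col_base_full E) (row_base_free E).
  rewrite rE => J P JP fJ fP; exists J, P; split=> //; exact/eqP.
exists J, P; split=> //.
- by apply: (rank_col_inj rJ); rewrite mulmxA JP.
- by apply: (row_free_inj rP); rewrite mul0mx -mulmxA JP.
- apply: (row_free_inj rP); rewrite mul1mx; apply/eqP; rewrite -subr_eq0; apply/eqP.
  apply: (rank_col_inj rJ); rewrite mulmxBr !mulmxA JP -mulmxA JP mulmxBr mulmx1.
  by rewrite mulmxA EC mul0mx subr0 subrr.
- by rewrite JP addrC subrK.
Qed.

End LinearAlgebra.

(** * Affine matrix problems and the quotient step *)

Section Quotient.
Variable K : fieldType.

Notation constraints p n := {vspace ('M[K]_(p, n) * K^o)%type}.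

(** The second component of a constraint is the prescribed trace; keeping it
    inside the vector space lets dimension counts see the values as well. *)
Definition solvable n p (N : 'M[K]_(n, p)) (D : constraints p n) : Prop :=
  exists A : 'M[K]_(n, p), (forall w, w \in D -> \tr (w.1 *m A) = w.2) /\
    forall l : K, \rank (A + l *: N)%R = p.

Definition cut_fun p n p' t (Q : 'M[K]_(p', p)) (C : 'M[K]_(n, t))
  (w : ('M[K]_(p, n) * K^o)%type) : 'M[K]_(p', t) := Q *m w.1 *m C.

Fact cut_fun_linear p n p' t Q C : linear (@cut_fun p n p' t Q C).
Proof. by move=> a u v; rewrite /cut_fun /= linearP mulmxDl /= -scalemxAl. Qed.

HB.instance Definition _ p n p' t Q C :=
  GRing.isLinear.Build K _ _ _ (@cut_fun p n p' t Q C) (@cut_fun_linear p n p' t Q C).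

Definition cut p n p' t Q C := linfun (@cut_fun p n p' t Q C).

Lemma cutE p n p' t Q C w : @cut p n p' t Q C w = Q *m w.1 *m C.
Proof. by rewrite lfunE. Qed.

Definition shrink_fun p n p' n' t (Xp : 'M[K]_(t, p)) (Q : 'M[K]_(p', p))
    (C : 'M[K]_(n, t)) (J : 'M[K]_(n, n'))
    (w : ('M[K]_(p, n) * K^o)%type) : ('M[K]_(p', n') * K^o)%type :=
  (Q *m w.1 *m J, w.2 - \tr (Xp *m w.1 *m C)).

Fact shrink_fun_linear p n p' n' t Xp Q C J : linear (@shrink_fun p n p' n' t Xp Q C J).
Proof.
move=> a u v; congr pair; rewrite /= linearP mulmxDl /= -scalemxAl //.
by rewrite mxtraceD mxtraceZ scalerBr opprD addrACA.
Qed.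

HB.instance Definition _ p n p' n' t Xp Q C J :=
  GRing.isLinear.Build K _ _ _ (@shrink_fun p n p' n' t Xp Q C J)
    (@shrink_fun_linear p n p' n' t Xp Q C J).

Definition shrink p n p' n' t Xp Q C J := linfun (@shrink_fun p n p' n' t Xp Q C J).

Lemma shrinkE p n p' n' t Xp Q C J w :
  @shrink p n p' n' t Xp Q C J w = (Q *m w.1 *m J, w.2 - \tr (Xp *m w.1 *m C)).
Proof. by rewrite lfunE. Qed.

(** The constraints of the quotient problem obtained by prescribing [A *m X = C]:
    [Q] projects onto the quotient by [X], and [Xp] reads the coordinates along [X]. *)
Definition quot p n p' n' t (Xp : 'M[K]_(t, p)) (Q : 'M[K]_(p', p))
    (C : 'M[K]_(n, t)) (J : 'M[K]_(n, n')) (D : constraints p n) : constraints p' n' :=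
  (shrink Xp Q C J @: (D :&: lker (cut Q C)))%VS.

Lemma mem_quotP p n p' n' t Xp Q C J (D : constraints p n)
    (w' : ('M[K]_(p', n') * K^o)%type) :
  reflect (exists w : ('M[K]_(p, n) * K^o)%type, [/\ w \in D, Q *m w.1 *m C = 0 &
                       w' = (Q *m w.1 *m J, w.2 - \tr (Xp *m w.1 *m C))])
    (w' \in @quot p n p' n' t Xp Q C J D).
Proof.
apply: (iffP memv_imgP) => [[w]|[w [wD cw ->]]].
  rewrite memv_cap memv_ker cutE shrinkE => /andP [wD /eqP cw] ->.
  by exists w.
by exists w; rewrite ?shrinkE // memv_cap wD memv_ker cutE cw eqxx.
Qed.

(** A step loses constraints for two reasons: those that do not preserve the
    prescribed flag, and those that become trivial on the quotient. *)
Lemma dim_quot p n p' n' t Xp Q C J D :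
  (\dim (@quot p n p' n' t Xp Q C J D) + \dim (cut Q C @: D)
    + \dim (D :&: lker (cut Q C) :&: lker (shrink Xp Q C J)) = \dim D)%N.
Proof.
rewrite -(limg_ker_dim (cut Q C) D) -(limg_ker_dim (shrink Xp Q C J) (D :&: _)).
by rewrite /quot addnAC [X in (X + _)%N]addnC.
Qed.

Lemma dim_quot_le p n p' n' t Xp Q C J D :
  (\dim (@quot p n p' n' t Xp Q C J D) <= \dim D)%N.
Proof. by rewrite -(dim_quot Xp Q C J D) -addnA leq_addr. Qed.

Lemma dim_quot_cut p n p' n' t Xp Q C J (D : constraints p n) w :
  w \in D -> Q *m w.1 *m C != 0 ->
  (\dim (@quot p n p' n' t Xp Q C J D) < \dim D)%N.
Proof.
move=> wD cw; rewrite -(dim_quot Xp Q C J D) -addnA -addn1 leq_add2l.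
rewrite addn_gt0 lt0n dimv_eq0; apply/orP; left.
apply: contraNneq cw => e; have : cut Q C w \in (cut Q C @: D)%VS by exact: memv_img.
by rewrite e memv0 cutE.
Qed.

Lemma dim_quot_ker p n p' n' t Xp Q C J D (U : constraints p n) :
  (U <= D)%VS ->
  (forall w, w \in U -> [/\ Q *m w.1 *m C = 0, Q *m w.1 *m J = 0 &
      w.2 = \tr (Xp *m w.1 *m C)]) ->
  (\dim (@quot p n p' n' t Xp Q C J D) + \dim U <= \dim D)%N.
Proof.
move=> UD HU; rewrite -(dim_quot Xp Q C J D) -addnA leq_add2l.
apply: leq_trans (leq_addl _ _); apply/dimvS/subvP => w wU.
have [h1 h2 h3] := HU w wU.
by rewrite !memv_cap (subvP UD) // !memv_ker cutE shrinkE h1 h2 h3 subrr !eqxx.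
Qed.

Lemma factor_trace p n p' t (Q : 'M[K]_(p', p)) (C : 'M[K]_(n, t)) (D : constraints p n)
    (g : 'M[K]_(p, n) * K^o -> K) :
  scalar g -> (forall w, w \in D -> Q *m w.1 *m C = 0 -> g w = 0) ->
  exists R : 'M[K]_(t, p'), forall w, w \in D -> \tr (R *m (Q *m w.1 *m C)) = g w.
Proof.
move=> lg H.
have [G GE] := @linfunP K ('M[K]_(p, n) * K^o)%type K^o g lg.
have [|h hE] := @factor_functional K _ _ D (cut Q C) G.
  by move=> w wD; rewrite cutE GE; apply: H.
have [|R RE] := @functional_trace K p' t (fun M => h M).
  by move=> a u v; rewrite linearP.
by exists R => w wD; rewrite -RE -cutE hE.
Qed.

(** Look for [A] as [C *m Xp + C *m R *m Q + J *m A' *m Q], block triangular with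
    invertible corner and [A'] on the quotients.  The rank does not depend on [R],
    and the pairing with [R] can take any values on the constraints that do not
    survive in the quotient. *)
Lemma step n p t n' p' (N : 'M[K]_(n, p)) (D : constraints p n)
    X Xp (L : 'M[K]_(p, p')) Q C Cp (J : 'M[K]_(n, n')) P :
  @splitting K p t p' X Xp L Q -> @splitting K n t n' C Cp J P -> N *m X = 0 ->
  solvable (P *m N *m L) (quot Xp Q C J D) -> solvable N D.
Proof.
move=> sX sC NX [A' [A'D rA']].
have [|w wD cw|R RE] := @factor_trace p n p' t Q C D
    (fun w => w.2 - \tr (Xp *m w.1 *m C) - \tr (Q *m w.1 *m J *m A')).
- move=> a u v /=; rewrite !mulmxDr -!scalemxAr !mulmxDl -!scalemxAl.
  rewrite !mxtraceD !mxtraceZ.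
  rewrite -![_ *: _]/(_ * _) !mulrBr !opprD; rewrite -!addrA.
  set x1 := a * _; set x2 := v.2; set x3 := - (_ * _); set x4 := - \tr _.
  set x5 := - (_ * _).
  rewrite [x2 + _]addrCA; congr (_ + (_ + _)).
  by rewrite [RHS]addrCA; congr (_ + _); rewrite addrCA.
- apply/eqP; rewrite subr_eq0 eq_sym; apply/eqP.
  by rewrite (A'D (Q *m w.1 *m J, w.2 - \tr (Xp *m w.1 *m C))) //; apply/mem_quotP; exists w.
exists (C *m Xp + C *m R *m Q + J *m A' *m Q); split=> [w wD|l].
  rewrite !mulmxDr !mxtraceD.
  have -> : \tr (w.1 *m (C *m Xp)) = \tr (Xp *m w.1 *m C).
    by rewrite mulmxA mxtrace_mulC mulmxA.
  have -> : \tr (w.1 *m (C *m R *m Q)) = w.2 - \tr (Xp *m w.1 *m C) - \tr (Q *m w.1 *m J *m A').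
    by rewrite -RE // mulmxA mxtrace_mulC mulmxA [RHS]mxtrace_mulC !mulmxA.
  have -> : \tr (w.1 *m (J *m A' *m Q)) = \tr (Q *m w.1 *m J *m A').
    by rewrite mulmxA mxtrace_mulC !mulmxA.
  by rewrite -addrA subrK addrC subrK.
have NE : N = N *m L *m Q.
  by rewrite -mulmxA -{1}[N]mulmx1 -(splitting_id sX) mulmxDr mulmxA NX mul0mx add0r.
apply: col_inj_rank => v Av.
have Qv : Q *m v = 0.
  apply: (rank_col_inj (rA' l)).
  have := congr1 (mulmx P) Av; rewrite mulmx0 mulmxA => <-.
  rewrite mulmxA; congr (_ *m v).
  rewrite !mulmxDr !mulmxA (splitting_pc sC) (splitting_pj sC) !mul0mx !add0r mul1mx.
  rewrite mulmxDl -scalemxAr -!scalemxAl; congr (_ + _ *: _).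
  by rewrite [in RHS]NE !mulmxA.
have Xv : Xp *m v = 0.
  move: Av; rewrite NE -!mulmxA !mulmxDl -!scalemxAl -!mulmxA Qv !mulmx0 scaler0 !addr0.
  by move/(congr1 (mulmx Cp)); rewrite mulmx0 mulmxA (splitting_lc sC) mul1mx.
by rewrite -[v]mul1mx -(splitting_id sX) mulmxDl -!mulmxA Qv Xv !mulmx0 addr0.
Qed.

End Quotient.
Arguments mem_quotP {K p n p' n' t Xp Q C J D w'}.

(** * Reading constraints off the quotient *)

Section QuotientFacts.
Variable K : fieldType.
Notation constraints p n := {vspace ('M[K]_(p, n) * K^o)%type}.

Definition tr_constraint n (w : ('M[K]_n * K^o)%type) : ('M[K]_n * K^o)%type :=
  (w.1^T, w.2).

Lemma transpose_constraints n (D : constraints n n) :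
  exists2 D' : constraints n n, (\dim D' <= \dim D)%N &
    forall w, (w \in D') = (tr_constraint w \in D).
Proof.
have [|F FE] := @linfunP K _ _ (@tr_constraint n).
  by move=> a u v; congr pair; rewrite /= linearP.
exists (F @: D)%VS => [|w]; first by rewrite -(limg_ker_dim F D) leq_addl.
apply/memv_imgP/idP => [[v vD ->]|wD].
  by rewrite FE /tr_constraint /= trmxK -surjective_pairing.
by exists (tr_constraint w) => //; rewrite FE /tr_constraint /= trmxK -surjective_pairing.
Qed.

Lemma solvable_transpose n (N : 'M[K]_n) (D D' : constraints n n) :
  (forall w, w \in D -> tr_constraint w \in D') -> solvable N^T D' -> solvable N D.
Proof.
move=> DD' [A [AD rA]]; exists A^T; split=> [w /DD' /AD /= <-|l].
  by rewrite mxtrace_mulC -mxtrace_tr trmx_mul trmxK.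
by rewrite -mxrank_tr linearD linearZ /= trmxK rA.
Qed.

Lemma rank_mulmx_lt n m p (P : 'M[K]_(m, n)) (N : 'M[K]_(n, p)) (z : 'cV[K]_p) :
  N *m z != 0 -> P *m (N *m z) = 0 -> (\rank (P *m N) < \rank N)%N.
Proof.
move=> Nz PNz; rewrite ltn_neqAle mxrankM_maxr andbT.
apply: contraNN Nz; rewrite (mxrank_leqif_sup (submxMl P N)) => /submxP [R ->].
by rewrite -!mulmxA PNz mulmx0.
Qed.

(** Here [N *m X = 0], and [P *m N *m L] is the map induced by [N] from the quotient
    by [X] to the quotient by [C].  The lemmas below translate vanishing conditions
    on the induced maps back to [N] and [B]. *)
Section Split.
Variables (n p t n' p' : nat) (N : 'M[K]_(n, p)).
Variables (X : 'M[K]_(p, t)) (Xp : 'M[K]_(t, p)) (L : 'M[K]_(p, p')) (Q : 'M[K]_(p', p)).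
Variables (C : 'M[K]_(n, t)) (Cp : 'M[K]_(t, n)) (J : 'M[K]_(n, n')) (P : 'M[K]_(n', n)).
Hypotheses (sX : splitting X Xp L Q) (sC : splitting C Cp J P) (NX : N *m X = 0).

Lemma split_kernel m (M : 'M[K]_(p, m)) : Q *m M = 0 -> M = X *m (Xp *m M).
Proof.
by move=> QM; rewrite mulmxA -[LHS]mul1mx -(splitting_id sX) mulmxDl -(mulmxA L) QM mulmx0 addr0.
Qed.

Lemma split_image m (M : 'M[K]_(n, m)) : P *m M = 0 -> M = C *m (Cp *m M).
Proof.
by move=> PM; rewrite mulmxA -[LHS]mul1mx -(splitting_id sC) mulmxDl -(mulmxA J) PM mulmx0 addr0.
Qed.

Lemma split_mulLQ : N *m L *m Q = N.
Proof. by rewrite -[RHS]mulmx1 -(splitting_id sX) mulmxDr mulmxA NX mul0mx add0r mulmxA. Qed.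

Lemma split_mulr_eq0 m (M : 'M[K]_(m, p)) : M *m X = 0 -> M *m L = 0 -> M = 0.
Proof.
by move=> MX ML; rewrite -[M]mulmx1 -(splitting_id sX) mulmxDr !mulmxA MX ML !mul0mx addr0.
Qed.

Lemma rank_quot : \rank (P *m N *m L) = \rank (P *m N).
Proof.
apply/eqP; rewrite eqn_leq mxrankM_maxl /=.
by rewrite -{1}split_mulLQ !mulmxA mxrankM_maxl.
Qed.

Lemma rank_quot_ge : (\rank N <= t + \rank (P *m N))%N.
Proof.
rewrite -[leqLHS](congr1 mxrank (mul1mx N)) -(splitting_id sC) mulmxDl -!mulmxA.
apply: leq_trans (mxrank_add _ _) _; apply: leq_add; last exact: mxrankM_maxr.
exact: leq_trans (mxrankM_maxl _ _) (rank_leq_col _).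
Qed.

Section Constraint.
Variable B : 'M[K]_(p, n).
Hypothesis QBC : Q *m B *m C = 0.

Lemma quot_NBC : N *m B *m C = 0.
Proof. by rewrite -mulmxA (@split_kernel _ (B *m C)) ?mulmxA // NX !mul0mx. Qed.

Lemma quot_QBJP : Q *m B *m J *m P = Q *m B.
Proof. by rewrite -[RHS]mulmx1 -(splitting_id sC) mulmxDr !mulmxA QBC mul0mx add0r. Qed.

Lemma quot_mid_eq0 : (P *m N *m L) *m (Q *m B *m J) *m (P *m N *m L) = 0 ->
  exists h, N *m B *m N = C *m h.
Proof.
move=> e; exists (Cp *m (N *m B *m N)); apply: split_image.
apply: split_mulr_eq0; first by rewrite -!mulmxA NX !mulmx0.
rewrite -[RHS]e.
transitivity (P *m (N *m L *m Q) *m B *m N *m L); first by rewrite split_mulLQ !mulmxA.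
transitivity (P *m N *m L *m (Q *m B *m J *m P) *m N *m L); last by rewrite !mulmxA.
by rewrite quot_QBJP !mulmxA.
Qed.

Lemma quot_left_eq0 : (P *m N *m L) *m (Q *m B *m J) = 0 -> exists h, N *m B = C *m h.
Proof.
move=> e; exists (Cp *m (N *m B)); apply: split_image.
rewrite -[RHS](mul0mx _ P) -[in RHS]e.
transitivity (P *m (N *m L *m Q) *m B); first by rewrite split_mulLQ !mulmxA.
transitivity (P *m N *m L *m (Q *m B *m J *m P)); last by rewrite !mulmxA.
by rewrite quot_QBJP !mulmxA.
Qed.

Lemma quot_right_eq0 : (Q *m B *m J) *m (P *m N *m L) = 0 ->
  exists h, B *m N = X *m h.
Proof.
move=> e; exists (Xp *m (B *m N)); apply: split_kernel.
apply: split_mulr_eq0; first by rewrite -!mulmxA NX !mulmx0.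
by rewrite -[RHS]e !mulmxA quot_QBJP.
Qed.

End Constraint.
End Split.
End QuotientFacts.

(** * Problems whose kernel is a line *)

Section Corank1.
Variable K : fieldType.
Notation constraints p n := {vspace ('M[K]_(p, n) * K^o)%type}.

Lemma left_inverse_col n (x : 'cV[K]_n) : x != 0 -> exists u : 'rV_n, u *m x = 1%:M.
Proof.
by move=> x0; apply: full_rank_left_inverse; apply/eqP; rewrite eqn_leq rank_leq_col lt0n mxrank_eq0.
Qed.

Lemma kernel_vector n p (N : 'M[K]_(n, p)) : (\rank N < p)%N ->
  exists (x : 'cV_p) (u : 'rV_p), N *m x = 0 /\ u *m x = 1%:M.
Proof.
move=> rN; have [X [rX NX _]] := kernel_basis N.
have : X != 0 by rewrite -mxrank_eq0 rX -lt0n subn_gt0.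
case/matrix0Pn => i [j Xij].
have [|u ux] := @left_inverse_col _ (col j X).
  by apply/matrix0Pn; exists i, 0; rewrite mxE.
by exists (col j X), u; rewrite colE mulmxA NX mul0mx -colE.
Qed.

Lemma kernel_line n (N : 'M[K]_n.+1) (x : 'cV_n.+1) (u : 'rV_n.+1) m (M : 'M_(n.+1, m)) :
  \rank N = n -> N *m x = 0 -> u *m x = 1%:M -> N *m M = 0 -> M = x *m (u *m M).
Proof.
move=> rN Nx ux NM; have [X [_ NX kX]] := kernel_basis N.
have [y My] := kX _ _ NM; have [a xa] := kX _ _ Nx.
move: X {NX kX} y a My xa; have -> : (n.+1 - \rank N = 1)%N by rewrite rN subSnn.
move=> X y a -> xa; have ae : a *m (u *m X) = 1%:M.
  by apply: mulmx1C; rewrite -mulmxA -xa.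
by rewrite xa -mulmxA; congr (X *m _); rewrite !mulmxA -(mulmxA a) ae mul1mx.
Qed.

(** A step with [C = N *m z] creates a new constraint with [N B N = 0] only from
    some [B] for which [N B N] has rank one with column space spanned by [N *m z];
    by [rank1_span] those [z] span a small subspace. *)
Lemma good_directions n (N : 'M[K]_n.+1) (D : constraints n.+1 n.+1) : \rank N = n ->
  exists2 Y : {vspace 'cV[K]_n.+1}, (\dim Y + \dim (D :&: lker (cut N N)) <= (\dim D).+1)%N &
    forall z, z \notin Y -> N *m z != 0 /\
      forall w h, w \in D -> N *m w.1 *m N = N *m z *m h -> N *m w.1 *m N = 0.
Proof.
move=> rN; have [X dX XP] := rank1_span (cut N N @: D).
have [|F FE] := @linfunP K _ _ (fun z : 'cV[K]_n.+1 => N *m z).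
  by move=> a u v; rewrite mulmxDr -scalemxAr.
exists (F @^-1: X)%VS => [|z]; last first.
  rewrite -memv_preim FE => zX; split=> [|w h wD e].
    by apply: contraNneq zX => ->; rewrite mem0v.
  apply/eqP/negPn/negP => h0; case/negP: zX; apply: (XP _ h).
    by rewrite -e -cutE memv_img.
  by apply: contraNneq h0 => h0; rewrite e h0 mulmx0.
apply: leq_trans (leq_add (dim_preim_le F X) (leqnn _)) _.
rewrite (dim_lker_mulmx FE) rN subSnn add1n addSn ltnS -(limg_ker_dim (cut N N) D).
by rewrite addnC leq_add2l.
Qed.

Lemma rank_image_step n m r (N : 'M[K]_n) (z : 'cV_n) Cp J (P : 'M_(m, n)) :
  splitting (N *m z) Cp J P -> \rank N = r.+1 -> \rank (P *m N) = r.
Proof.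
move=> sC rN.
have := rank_quot_ge N sC; rewrite rN.
have : (\rank (P *m N) < \rank N)%N.
  apply: (rank_mulmx_lt _ (splitting_pc sC)); apply: contra_eq_neq (splitting_lc sC) => ->.
  by rewrite mulmx0 eq_sym oner_eq0.
rewrite rN; lia.
Qed.

(** Choose [z] away from the bad directions and such that some constraint is lost:
    the hypothesis on [N B N] is inherited by the quotient, until no constraint is
    left. *)
Lemma solvable_independent n (N : 'M[K]_n.+1) (D : constraints n.+1 n.+1) :
  \rank N = n -> (\dim D <= n.-1)%N ->
  (forall w, w \in D -> N *m w.1 *m N = 0 -> w = 0) -> solvable N D.
Proof.
elim: n => [|n IH] in N D *; move=> rN dD DN.
  have /eqP N0 : N == 0 by rewrite -mxrank_eq0 rN.
  exists 1%:M; split=> [w /DN|l]; last by rewrite N0 scaler0 addr0 mxrank1.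
  by rewrite N0 mulmx0 => ->; rewrite // mul0mx mxtrace0.
have [|x [u [Nx ux]]] := @kernel_vector _ _ N; first by rewrite rN.
have [Y dY YP] := good_directions D rN.
have [z [zY zcut]] : exists z, z \notin Y /\
    (D = 0%VS \/ exists2 w, w \in D & N *m w.1 *m N *m z != 0).
  have dY' : (\dim Y < n.+2)%N by move: dY dD => /=; lia.
  have [->|D0] := eqVneq D 0%VS.
    have /subvPn [z _ zY] : ~~ (fullv <= Y)%VS by rewrite full_not_sub // dim_cV.
    by exists z; split=> //; left.
  pose w0 := vpick D; have w0D : w0 \in D := memv_pick D.
  have [|F FE] := @linfunP K _ _ (fun z : 'cV[K]_n.+2 => N *m w0.1 *m N *m z).
    by move=> a v v'; rewrite mulmxDr -scalemxAr.
  have [||z [_ zY zF]] := @avoid2 _ _ fullv Y (lker F); rewrite ?full_not_sub ?dim_cV //.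
    rewrite (dim_lker_mulmx FE) ltn_subrL lt0n mxrank_eq0 ltnS leq0n andbT.
    by apply: contraNneq D0 => /(DN _ w0D) /eqP; rewrite vpick0.
  by exists z; split=> //; right; exists w0 => //; rewrite -FE -memv_ker.
have [Nz zgood] := YP z zY.
have [Cp CpC] := left_inverse_col Nz.
have [L [Q sX]] := @splitting_exists K n.+2 1 n.+1 x u (erefl _) ux.
have [J [P sC]] := @splitting_exists K n.+2 1 n.+1 (N *m z) Cp (erefl _) CpC.
apply: (step sX sC Nx); apply: IH.
- by rewrite (rank_quot _ sX Nx) (rank_image_step sC rN).
- case: zcut => [D0|[w0 w0D cw0]].
    by apply: leq_trans (dim_quot_le _ _ _ _ _) _; rewrite D0 dimv0.
  have : (\dim (quot u Q (N *m z) J D) < \dim D)%N.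
    apply: (dim_quot_cut _ _ w0D); apply: contraNneq cw0 => e.
    by rewrite -mulmxA (quot_NBC sX Nx e).
  by move: dD => /=; lia.
move=> w' /mem_quotP [w [wD cw ->]] /= /(quot_mid_eq0 sX sC Nx cw) [h e].
have w0 : w = 0 by apply: DN => //; apply: zgood e.
by rewrite w0 /= !(mulmx0, mul0mx) mxtrace0 subr0.
Qed.

Definition left_null n (N : 'M[K]_n) (D : constraints n n) : constraints n n :=
  (D :&: lker (cut N 1%:M))%VS.

Lemma mem_left_null n (N : 'M[K]_n) (D : constraints n n) w :
  (w \in left_null N D) = (w \in D) && (N *m w.1 == 0).
Proof. by rewrite memv_cap memv_ker cutE mulmx1. Qed.

Lemma left_null_killed n (N : 'M[K]_n.+1) (D : constraints n.+1 n.+1) x u (L : 'M_(n.+1, n))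
    Q C (J : 'M[K]_(n.+1, n)) :
  \rank N = n -> N *m x = 0 -> @splitting K n.+1 1 n x u L Q ->
  (forall w, w \in left_null N D -> u *m w.1 *m C = (w.2 : K)%:M) ->
  forall w, w \in left_null N D ->
    [/\ Q *m w.1 *m C = 0, Q *m w.1 *m J = 0 & w.2 = \tr (u *m w.1 *m C)].
Proof.
move=> rN Nx sX uC w wD0; rewrite uC // mxtrace_scalar; split=> //.
all: move: wD0; rewrite mem_left_null => /andP [_ /eqP NB].
all: rewrite (kernel_line rN Nx (splitting_lc sX) NB) (mulmxA Q) (splitting_pc sX).
all: by rewrite !mul0mx.
Qed.

(** When the kernel of [N] is spanned by [x], a constraint with [N B = 0] reads
    [B = x *m h] and involves only the column [C] of [A], on which it is an affine
    condition.  Impose all of these conditions on [C = N *m z], in addition to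
    genericity; they disappear in the quotient. *)
Lemma solvable_left_null n (N : 'M[K]_n.+1) (D : constraints n.+1 n.+1) :
  \rank N = n -> (\dim D <= n.-1)%N ->
  (forall w, w \in D -> N *m w.1 *m N = 0 -> N *m w.1 = 0) ->
  (forall w, w \in D -> N *m w.1 = 0 -> w.1 *m N = 0 -> w = 0) -> solvable N D.
Proof.
move=> rN dD H1 H2.
have [D00|D00] := eqVneq (left_null N D) 0%VS.
  apply: solvable_independent => // w wD /H1 - /(_ wD) NB.
  by apply/eqP; rewrite -memv0 -D00 mem_left_null wD NB eqxx.
have dD0 : (0 < \dim (left_null N D))%N by rewrite lt0n dimv_eq0.
have D0D : (left_null N D <= D)%VS by exact: capvSl.
case: n => [|n] in N D rN dD H1 H2 D00 dD0 D0D *.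
  by have := leq_trans dD0 (leq_trans (dimvS D0D) dD).
have [|x [u [Nx ux]]] := @kernel_vector _ _ N; first by rewrite rN.
have [Y dY YP] := good_directions D rN.
have [|t tE] := @linfunP K _ K^o (fun w : ('M[K]_n.+2 * K^o)%type => w.2).
  by move=> a v v'.
have [||z [zY zE]] := @affine_avoid K _ n.+2 (left_null N D) (cut u N) t Y.
- move=> w; rewrite mem_left_null => /andP [wD /eqP NB]; rewrite cutE tE => uBN.
  rewrite (H2 w wD NB) //.
  by rewrite (kernel_line rN Nx ux NB) -mulmxA uBN mulmx0.
- rewrite ltnS; apply: leq_trans (leq_trans dY _); last by rewrite ltnS.
  rewrite leq_add2l; apply/dimvS/subvP => w; rewrite mem_left_null => /andP [wD /eqP NB].
  by rewrite memv_cap wD memv_ker cutE NB mul0mx eqxx.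
have [Nz zgood] := YP z zY.
have [Cp CpC] := left_inverse_col Nz.
have [L [Q sX]] := @splitting_exists K n.+2 1 n.+1 x u (erefl _) ux.
have [J [P sC]] := @splitting_exists K n.+2 1 n.+1 (N *m z) Cp (erefl _) CpC.
have killed : forall w, w \in left_null N D ->
    [/\ Q *m w.1 *m (N *m z) = 0, Q *m w.1 *m J = 0 & w.2 = \tr (u *m w.1 *m (N *m z))].
  apply: (left_null_killed J rN Nx sX) => w wD0.
  by rewrite mulmxA -cutE zE // tE.
apply: (step sX sC Nx); apply: solvable_independent.
- by rewrite (rank_quot _ sX Nx) (rank_image_step sC rN).
- have := dim_quot_ker D0D killed; move: dD dD0 => /=; lia.
move=> w' /mem_quotP [w [wD cw ->]] /= /(quot_mid_eq0 sX sC Nx cw) [h e].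
have NB : N *m w.1 = 0 by apply: H1 => //; apply: zgood e.
have [|_ -> ->] := killed w; first by rewrite mem_left_null wD NB eqxx.
by rewrite subrr.
Qed.

(** The extreme case of [solvable_left_null] with one more constraint: then the affine
    conditions may determine [C], and a nonzero prescribed value guarantees that
    [C] is nonzero. *)
Lemma solvable_all_left_null n (N : 'M[K]_n.+1) (D : constraints n.+1 n.+1) w1 :
  \rank N = n -> (\dim D <= n)%N ->
  (forall w, w \in D -> N *m w.1 = 0) ->
  (forall w, w \in D -> w.1 *m N = 0 -> w = 0) ->
  w1 \in D -> w1.2 != 0 -> solvable N D.
Proof.
move=> rN dD H1 H2 w1D w1t.
case: n => [|n] in N D rN dD H1 H2 w1 w1D w1t *.
  move: dD w1D w1t; rewrite leqn0 dimv_eq0 => /eqP ->.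
  by rewrite memv0 => /eqP ->; rewrite eqxx.
have [|x [u [Nx ux]]] := @kernel_vector _ _ N; first by rewrite rN.
have [|t tE] := @linfunP K _ K^o (fun w : ('M[K]_n.+2 * K^o)%type => w.2).
  by move=> a v v'.
have [||z [_ zE]] := @affine_avoid K _ n.+2 D (cut u N) t 0%VS.
- move=> w wD; rewrite cutE tE => uBN; rewrite (H2 w wD) //.
  by rewrite (kernel_line rN Nx ux (H1 w wD)) -mulmxA uBN mulmx0.
- by rewrite dimv0.
have Nz : N *m z != 0.
  apply: contraNneq w1t => Nz; have := zE _ w1D.
  rewrite cutE tE -[_ *m z]mulmxA Nz mulmx0 => /(congr1 (fun M : 'M_1 => M 0 0)).
  by rewrite !mxE eqxx => /esym/eqP.
have [Cp CpC] := left_inverse_col Nz.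
have [L [Q sX]] := @splitting_exists K n.+2 1 n.+1 x u (erefl _) ux.
have [J [P sC]] := @splitting_exists K n.+2 1 n.+1 (N *m z) Cp (erefl _) CpC.
have DD0 w : w \in D -> w \in left_null N D.
  by move=> wD; rewrite mem_left_null wD H1 ?eqxx.
have killed w : w \in D -> [/\ Q *m w.1 *m (N *m z) = 0, Q *m w.1 *m J = 0 &
    w.2 = \tr (u *m w.1 *m (N *m z))].
  move=> /DD0 wD0; apply: (left_null_killed J rN Nx sX) (wD0) => {wD0}w.
  by rewrite mem_left_null => /andP [wD _]; rewrite mulmxA -cutE zE // tE.
apply: (step sX sC Nx); apply: solvable_independent.
- by rewrite (rank_quot _ sX Nx) (rank_image_step sC rN).
- have := dim_quot_ker (subvv D) killed; lia.
by move=> w' /mem_quotP [w [wD _ ->]] /= _; have [_ -> ->] := killed w wD; rewrite subrr.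
Qed.

Lemma cokernel_line n (N : 'M[K]_n.+1) (y : 'rV_n.+1) (v : 'cV_n.+1) m (M : 'M_(m, n.+1)) :
  \rank N = n -> y *m N = 0 -> y *m v = 1%:M -> M *m N = 0 -> M = M *m v *m y.
Proof.
move=> rN yN yv MN; apply: trmx_inj; rewrite !trmx_mul.
apply: (@kernel_line _ N^T); rewrite ?mxrank_tr -?trmx_mul ?yN ?yv ?MN ?trmx0 ?trmx1 //.
Qed.

(** A step in a generic direction of the image of [N], followed by a transposition.
    Constraints with [N B N = 0] lose their row part [u *m B *m N], which was tested
    against [z], and only keep their column part [N *m B *m v]; after transposition
    they have their image in the kernel.  The condition on [N *m z] says that this
    column part does not die in the quotient. *)
Lemma transposed_image_step n (N : 'M[K]_n.+2) (D : constraints n.+2 n.+2)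
    (x z v : 'cV_n.+2) (u y : 'rV_n.+2) :
  \rank N = n.+1 -> N *m x = 0 -> u *m x = 1%:M -> y *m N = 0 -> y *m v = 1%:M ->
  N *m z != 0 ->
  (forall w, w \in D -> N *m w.1 = 0 -> w = 0) ->
  (forall w h, w \in D -> N *m w.1 *m N = N *m z *m h -> N *m w.1 *m N = 0) ->
  N *m z \notin (cut N v @: (D :&: lker (cut N N)))%VS ->
  exists (N' : 'M[K]_n.+1) (D' : constraints n.+1 n.+1),
    [/\ \rank N' = n, solvable N' D' -> solvable N D,
        forall w, w \in D' -> N' *m w.1 *m N' = 0 -> N' *m w.1 = 0,
        forall w, w \in D' -> N' *m w.1 = 0 -> w.1 *m N' = 0 -> w = 0 &
    [/\ (\dim D' <= \dim D)%N,
        (forall w, w \in D -> N *m w.1 *m N *m z != 0 -> (\dim D' < \dim D)%N),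
        ((forall w, w \in D -> N *m w.1 *m N = 0) ->
          forall w, w \in D' -> N' *m w.1 = 0) &
        forall w, w \in D -> N *m w.1 *m N *m z = 0 ->
          exists2 w', w' \in D' & w'.2 = w.2 - \tr (u *m w.1 *m (N *m z))]].
Proof.
move=> rN Nx ux yN yv Nz DN zgood zD0.
have {zD0} NzD0 w : w \in D -> N *m w.1 *m N = 0 ->
    forall k : K, k *: (N *m z) = N *m w.1 *m v -> k = 0.
  move=> wD NBN k kE; apply/eqP; apply: contraR zD0 => k0.
  rewrite -[N *m z](scalerK k0) kE memvZ // -cutE memv_img //.
  by rewrite memv_cap wD memv_ker cutE NBN eqxx.
have [Cp CpC] := left_inverse_col Nz.
have [L [Q sX]] := @splitting_exists K n.+2 1 n.+1 x u (erefl _) ux.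
have [J [P sC]] := @splitting_exists K n.+2 1 n.+1 (N *m z) Cp (erefl _) CpC.
have [D' dD' D'P] := transpose_constraints (quot u Q (N *m z) J D).
have BN0 w : Q *m w.1 *m (N *m z) = 0 -> N *m w.1 *m N = 0 ->
    (P *m N *m L)^T *m (Q *m w.1 *m J)^T = 0.
  move=> cw; rewrite -mulmxA => NBN; rewrite -trmx_mul.
  have BN := kernel_line rN Nx ux NBN.
  rewrite !mulmxA (quot_QBJP sC cw) -(mulmxA Q) BN.
  by rewrite (mulmxA Q) (splitting_pc sX) !mul0mx trmx0.
exists (P *m N *m L)^T, D'; split.
- by rewrite mxrank_tr (rank_quot _ sX Nx) (rank_image_step sC rN).
- move=> sol; apply: (step sX sC Nx); apply: solvable_transpose sol => w wD.
  by rewrite D'P /tr_constraint /= trmxK -surjective_pairing.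
- move=> w'; rewrite D'P => /mem_quotP [w [wD cw]] [w'E _].
  rewrite -[w'.1]trmxK w'E -!trmx_mul => /(congr1 trmx); rewrite trmxK trmx0 mulmxA.
  move=> /(quot_mid_eq0 sX sC Nx cw) [h /zgood-/(_ wD) NBN].
  by rewrite trmx_mul BN0.
- move=> w'; rewrite D'P => /mem_quotP [w [wD cw]] [w'E w't].
  rewrite -[w'.1]trmxK w'E -!trmx_mul => /(congr1 trmx); rewrite trmxK trmx0.
  move=> /(quot_right_eq0 sX sC Nx cw) [h BN] /(congr1 trmx); rewrite trmxK trmx0.
  move=> /(quot_left_eq0 sX sC Nx cw) [g NB].
  have NBN : N *m w.1 *m N = 0 by rewrite -mulmxA BN mulmxA Nx mul0mx.
  have NBv : N *m w.1 *m v = 0.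
    rewrite NB -mulmxA [g *m v]mx11_scalar mul_mx_scalar.
    rewrite (NzD0 w wD NBN ((g *m v) 0 0)) ?scale0r //.
    by rewrite NB -[RHS]mulmxA [in RHS](mx11_scalar (g *m v)) mul_mx_scalar.
  have w0 : w = 0 by apply: DN => //; rewrite (cokernel_line rN yN yv NBN) NBv mul0mx.
  have w'1 : w'.1 = 0 by rewrite -[w'.1]trmxK w'E w0 /= !(mulmx0, mul0mx) trmx0.
  have w'2 : w'.2 = 0 by rewrite w't w0 /= !(mulmx0, mul0mx) mxtrace0 subr0.
  by rewrite [w']surjective_pairing w'1 w'2.
split.
- exact: leq_trans dD' (dim_quot_le _ _ _ _ _).
- move=> w wD cw; apply: leq_ltn_trans dD' _.
  apply: (dim_quot_cut _ _ wD); apply: contraNneq cw => e.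
  by rewrite -mulmxA (quot_NBC sX Nx e).
- move=> NBN w'; rewrite D'P => /mem_quotP [w [wD cw]] [w'E _].
  by rewrite -[w'.1]trmxK w'E BN0 // NBN.
move=> w wD NBNz; have cw : Q *m w.1 *m (N *m z) = 0.
  have NBz : N *m (w.1 *m (N *m z)) = 0 by rewrite !mulmxA.
  by rewrite -mulmxA (kernel_line rN Nx ux NBz) mulmxA (splitting_pc sX) mul0mx.
exists ((Q *m w.1 *m J)^T, w.2 - \tr (u *m w.1 *m (N *m z))) => //.
by rewrite D'P /tr_constraint /= trmxK; apply/mem_quotP; exists w.
Qed.

Lemma coker_vector n p (N : 'M[K]_(n, p)) : (\rank N < n)%N ->
  exists (y : 'rV_n) (v : 'cV_n), y *m N = 0 /\ y *m v = 1%:M.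
Proof.
move=> rN; have [|y [v [yN vy]]] := @kernel_vector _ _ N^T; first by rewrite mxrank_tr.
exists y^T, v^T; rewrite -trmx_mul vy trmx1; split=> //.
by rewrite -[N]trmxK -trmx_mul yN trmx0.
Qed.

(** The last hypothesis leaves room for losing a constraint in the first step, as
    [solvable_left_null] requires. *)
Lemma solvable_corank1 n (N : 'M[K]_n.+1) (D : constraints n.+1 n.+1) :
  \rank N = n -> (\dim D <= n.-1)%N ->
  (forall w, w \in D -> N *m w.1 = 0 -> w = 0) ->
  (\dim D < n.-1)%N \/ (exists2 w, w \in D & N *m w.1 *m N != 0) -> solvable N D.
Proof.
move=> rN dD DN Dcut.
pose D0 := (D :&: lker (cut N N))%VS.
have memD0 w : (w \in D0) = (w \in D) && (N *m w.1 *m N == 0).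
  by rewrite memv_cap memv_ker cutE.
have [D00|D00] := eqVneq D0 0%VS.
  apply: solvable_independent => // w wD NBN.
  by apply/eqP; rewrite -memv0 -D00 memD0 wD NBN eqxx.
have dD0 : (0 < \dim D0)%N by rewrite lt0n dimv_eq0.
have D0D : (D0 <= D)%VS by exact: capvSl.
case: n => [|n] in N D rN dD DN Dcut D0 memD0 D00 dD0 D0D *.
  by have := leq_trans dD0 (leq_trans (dimvS D0D) dD).
have [|x [u [Nx ux]]] := @kernel_vector _ _ N; first by rewrite rN.
have [|y [v [yN yv]]] := @coker_vector _ _ N; first by rewrite rN.
have [Y dY YP] := good_directions D rN.
have [|F FE] := @linfunP K _ _ (fun z : 'cV[K]_n.+2 => N *m z).
  by move=> a z z'; rewrite mulmxDr -scalemxAr.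
pose Z := (F @^-1: (cut N v @: D0))%VS.
(* a step along [N *m z] with [z] outside [A] loses a constraint, unless there is one to spare anyway *)
have [A dA AP] : exists2 A : {vspace 'cV[K]_n.+2}, (\dim A < n.+2)%N &
    forall z, z \notin A -> (\dim D < n)%N \/
      exists2 w, w \in D & N *m w.1 *m N *m z != 0.
  case: Dcut => [dD'|[w wD NBN]].
    by exists 0%VS => [|z _]; rewrite ?dimv0 //; left.
  have [|G GE] := @linfunP K _ _ (fun z : 'cV[K]_n.+2 => N *m w.1 *m N *m z).
    by move=> a z z'; rewrite mulmxDr -scalemxAr.
  exists (lker G) => [|z zG].
    by rewrite (dim_lker_mulmx GE) ltn_subrL lt0n mxrank_eq0 NBN.
  by right; exists w => //; rewrite -GE -memv_ker.
have [|||z [zA zZ zY]] := @avoid3 K n.+2 A Z Y => //.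
- apply: leq_ltn_trans (dim_preim_le _ _) _.
  rewrite (dim_lker_mulmx FE) rN subSnn add1n ltnS.
  by apply: leq_ltn_trans (leq_trans _ (leq_trans (dimvS D0D) dD)) _ => //; 
     rewrite -[leqRHS](limg_ker_dim (cut N v)) leq_addl.
- rewrite addnC -addn2 -addnA addnC; move: dY dD dD0; rewrite -/D0 /=; lia.
have [Nz zgood] := YP z zY.
have zD0 : N *m z \notin (cut N v @: D0)%VS by rewrite -FE memv_preim.
have [N' [D' [rN' red D'1 D'2 [dD' cutD' _ _]]]] :=
  transposed_image_step rN Nx ux yN yv Nz DN zgood zD0.
apply/red/solvable_left_null => //.
case: (AP z zA) => [dD''|[w wD /(cutD' w wD)]]; last by move: dD => /=; lia.
by move: dD' dD''; lia.
Qed.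

(** Here the first step loses nothing.  It makes some prescribed value nonzero
    instead, so that [solvable_all_left_null] applies. *)
Lemma solvable_square_zero n (N : 'M[K]_n.+2) (D : constraints n.+2 n.+2) w0 :
  \rank N = n.+1 -> (\dim D <= n)%N ->
  (forall w, w \in D -> w.2 = 0) ->
  (forall w, w \in D -> N *m w.1 *m N = 0) ->
  (forall w, w \in D -> N *m w.1 = 0 -> w = 0) ->
  (forall w, w \in D -> w.1 *m N = 0 -> w = 0) ->
  w0 \in D -> w0 != 0 -> solvable N D.
Proof.
move=> rN dD D2 NBN DN DN' w0D w00.
have [|x [u [Nx ux]]] := @kernel_vector _ _ N; first by rewrite rN.
have [|y [v [yN yv]]] := @coker_vector _ _ N; first by rewrite rN.
have [|F FE] := @linfunP K _ _ (fun z : 'cV[K]_n.+2 => N *m z).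
  by move=> a z z'; rewrite mulmxDr -scalemxAr.
have [|G GE] := @linfunP K _ _ (fun z : 'cV[K]_n.+2 => w0.1 *m N *m z).
  by move=> a z z'; rewrite mulmxDr -scalemxAr.
pose D0 := (D :&: lker (cut N N))%VS.
have [||z [_ zZ zG]] := @avoid2 _ _ fullv (F @^-1: (cut N v @: D0))%VS (lker G).
- rewrite full_not_sub // dim_cV; apply: leq_ltn_trans (dim_preim_le _ _) _.
  rewrite (dim_lker_mulmx FE) rN subSnn add1n ltnS.
  apply: (@leq_ltn_trans (\dim D0)); first by rewrite -[leqRHS](limg_ker_dim (cut N v)) leq_addl.
  by apply: leq_ltn_trans (dimvS (capvSl _ _)) _; rewrite ltnS.
- rewrite full_not_sub // dim_cV (dim_lker_mulmx GE) ltn_subrL lt0n mxrank_eq0 andbT.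
  by apply: contraNneq w00 => /(DN' _ w0D) ->.
have zD0 : N *m z \notin (cut N v @: D0)%VS by rewrite -FE memv_preim.
have Nz : N *m z != 0 by apply: contraNneq zD0 => ->; rewrite mem0v.
have [|N' [D' [rN' red _ D'2 [dD' _ D'0 D't]]]] :=
    transposed_image_step rN Nx ux yN yv Nz DN _ zD0.
  by move=> w h wD _; apply: NBN.
have [|w1 w1D' w1t] := D't w0 w0D; first by rewrite NBN // mul0mx.
have {}D'0 := D'0 NBN.
apply/red/(solvable_all_left_null rN' (leq_trans dD' dD) D'0 _ w1D') => [w wD'|].
  exact: D'2 _ wD' (D'0 w wD').
rewrite w1t (D2 _ w0D) sub0r oppr_eq0.
have NBz : N *m (w0.1 *m (N *m z)) = 0 by rewrite !mulmxA NBN // mul0mx.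
apply: contraNneq zG => e0.
have uBNz : u *m (w0.1 *m (N *m z)) = 0.
  by rewrite [LHS]mx11_scalar -trace_mx11 mulmxA e0 raddf0.
by rewrite memv_ker GE -mulmxA (kernel_line rN Nx ux NBz) uBNz mulmx0.
Qed.

End Corank1.

(** * Affine problems with few constraints *)

Section Affine.
Variable K : fieldType.
Notation constraints p n := {vspace ('M[K]_(p, n) * K^o)%type}.

Definition consistent p n (D : constraints p n) : Prop :=
  forall w, w \in D -> w.1 = 0 -> w = 0.

Lemma avoid_kernel m n (M : 'M[K]_(m, n)) : M != 0 -> exists z : 'cV_n, M *m z != 0.
Proof.
case/matrix0Pn => i [j Mij]; exists (delta_mx j 0); rewrite -colE.
by apply/matrix0Pn; exists i, 0; rewrite mxE.
Qed.

Lemma avoid_kernels m m' n (M : 'M[K]_(m, n)) (M' : 'M[K]_(m', n)) :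
  M != 0 -> M' != 0 -> exists z : 'cV_n, M *m z != 0 /\ M' *m z != 0.
Proof.
have kerP q (A : 'M[K]_(q, n)) : A != 0 ->
    exists2 U : {vspace 'cV[K]_n}, ~~ (fullv <= U)%VS & forall z, (z \in U) = (A *m z == 0).
  move=> /avoid_kernel [z Az].
  have [|F FE] := @linfunP K _ _ (fun z : 'cV[K]_n => A *m z).
    by move=> a v v'; rewrite mulmxDr -scalemxAr.
  exists (lker F) => [|v]; last by rewrite memv_ker FE.
  by apply/subvPn; exists z; rewrite ?memvf // memv_ker FE.
move=> /kerP [U fU UE] /kerP [U' fU' UE'].
by have [z [_ zU zU']] := avoid2 fU fU'; exists z; rewrite -UE -UE'.
Qed.

(** Flanders: an affine space of codimension less than [n] contains a matrix of full
    column rank.  When [N] vanishes every column [C] is allowed, and each step can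
    be made to lose a constraint. *)
Lemma solvable_flanders n p (D : constraints p n) :
  (p <= n)%N -> (\dim D <= n.-1)%N -> consistent D -> solvable 0 D.
Proof.
elim: p n => [|p IH] n in D *.
  move=> _ _ Dc; exists 0; split=> [w wD|l]; last by apply/eqP; rewrite -leqn0 rank_leq_col.
  by rewrite (Dc w wD (flatmx0 _)) mulmx0 mxtrace0.
case: n => // n in D *; rewrite ltnS => pn dD Dc.
have [u ux] : exists u : 'rV[K]_p.+1, u *m (delta_mx 0 0 : 'cV_p.+1) = 1%:M.
  by apply: left_inverse_col; apply/matrix0Pn; exists 0, 0; rewrite mxE !eqxx oner_eq0.
move: (delta_mx 0 0 : 'cV_p.+1) ux => x ux.
have [L [Q sX]] := @splitting_exists K p.+1 1 p x u (erefl _) ux.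
pose D0 := (D :&: lker (cut Q 1%:M))%VS.
have memD0 w : (w \in D0) = (w \in D) && (Q *m w.1 == 0).
  by rewrite memv_cap memv_ker cutE mulmx1.
have D0D : (D0 <= D)%VS by exact: capvSl.
(* [D0]: the constraints that only involve the column [C] of [A] *)
have [C [C0 Ckill Ccut]] : exists C : 'cV[K]_n.+1, [/\ C != 0,
    forall w, w \in D0 -> w.2 = \tr (u *m w.1 *m C) &
    [\/ D = 0%VS, (0 < \dim D0)%N | exists2 w, w \in D & Q *m w.1 *m C != 0]].
  have [D00|D00] := eqVneq D0 0%VS; last first.
    have [|t tE] := @linfunP K _ K^o (fun w : ('M[K]_(p.+1, n.+1) * K^o)%type => w.2).
      by move=> a v v'.
    have [||C [C0 CE]] := @affine_avoid K _ n.+1 D0 (cut u 1%:M) t 0%VS.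
    - move=> w; rewrite memD0 => /andP [wD /eqP QB]; rewrite cutE mulmx1 tE => uB.
      by rewrite (Dc w wD) // (split_kernel sX QB) uB mulmx0.
    - by rewrite dimv0 ltnS; apply: leq_trans (dimvS D0D) dD.
    exists C; split; first by rewrite -memv0.
      by move=> w /CE; rewrite cutE mulmx1 tE => ->; rewrite mxtrace_scalar.
    by constructor 2; rewrite lt0n dimv_eq0.
  have C0E C w : w \in D0 -> w.2 = \tr (u *m w.1 *m C).
    by rewrite D00 memv0 => /eqP ->; rewrite /= mulmx0 mul0mx mxtrace0.
  have [->|Dn0] := eqVneq D 0%VS.
    exists (delta_mx 0 0); split; last by constructor 1.
      by apply/matrix0Pn; exists 0, 0; rewrite mxE !eqxx oner_eq0.
    exact: C0E.
  have [C cC] : exists C : 'cV_n.+1, Q *m (vpick D).1 *m C != 0.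
    apply: avoid_kernel; apply: contraNneq Dn0 => QB.
    have : vpick D \in D0 by rewrite memD0 memv_pick QB eqxx.
    by rewrite D00 memv0 vpick0.
  exists C; split; first by apply: contraNneq cC => ->; rewrite mulmx0.
    exact: C0E.
  by constructor 3; exists (vpick D); rewrite ?memv_pick.
have [Cp CpC] := left_inverse_col C0.
have [J [P sC]] := @splitting_exists K n.+1 1 n C Cp (erefl _) CpC.
have killed w : w \in D0 ->
    [/\ Q *m w.1 *m C = 0, Q *m w.1 *m J = 0 & w.2 = \tr (u *m w.1 *m C)].
  move=> wD0; rewrite -Ckill //; move: wD0; rewrite memD0 => /andP [_ /eqP ->].
  by rewrite !mul0mx.
apply: (step sX sC (mul0mx _ _)); rewrite mulmx0 mul0mx; apply: IH => //.
  case: Ccut => [D_0|dD0|[w wD cw]].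
  - by apply: leq_trans (dim_quot_le _ _ _ _ _) _; rewrite D_0 dimv0.
  - by have := dim_quot_ker D0D killed; move: dD dD0 => /=; lia.
  - by have := dim_quot_cut u J wD cw; move: dD => /=; lia.
move=> w' /mem_quotP [w [wD cw ->]] /= QBJ.
have [|_ _ ->] := killed w; last by rewrite QBJ subrr.
by rewrite memD0 wD -(quot_QBJP sC cw) QBJ mul0mx eqxx.
Qed.

(** The bound on [left_null N D] compares it with the kernel of [N]: its dimension
    must be less than that of the kernel. *)
Definition small_left_null n (N : 'M[K]_n.+1) (D : constraints n.+1 n.+1) : Prop :=
  [/\ \rank N <= n, \dim D <= n.-2, consistent D & \dim (left_null N D) + \rank N <= n]%N.

(** With [C] outside the image of [N] the rank of [N] is unchanged, so the
    kernel loses exactly the vector [x], and no new constraint gets its image inside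
    the kernel. *)
Lemma small_left_null_step n (N : 'M[K]_n.+2) (D : constraints n.+2 n.+2)
    (x C : 'cV_n.+2) (u y : 'rV_n.+2) :
  (forall N' D', @small_left_null n N' D' -> solvable N' D') ->
  (\rank N <= n)%N -> (\dim (left_null N D) + \rank N <= n.+1)%N ->
  N *m x = 0 -> u *m x = 1%:M -> (forall w h, w \in D -> w.1 = x *m h -> w = 0) ->
  y *m N = 0 -> y *m C != 0 ->
  left_null N D = 0%VS \/
    (exists2 w, w \in left_null N D & w.1 *m C != x *m (u *m w.1 *m C)) ->
  (forall L Q (J : 'M_(n.+2, n.+1)), @splitting K n.+2 1 n.+1 x u L Q ->
     (\dim (quot u Q C J D) <= n.-2)%N) ->
  solvable N D.
Proof.
move=> IH rN dD0 Nx ux Dx yN yC cutC dimD.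
have C0 : C != 0 by apply: contraNneq yC => ->; rewrite mulmx0.
have [Cp CpC] := left_inverse_col C0.
have [L [Q sX]] := @splitting_exists K n.+2 1 n.+1 x u (erefl _) ux.
have [J [P sC]] := @splitting_exists K n.+2 1 n.+1 C Cp (erefl _) CpC.
have y0 m (h : 'M_(1, m)) : y *m C *m h = 0 -> h = 0.
  rewrite [y *m C]mx11_scalar mul_scalar_mx => /eqP; rewrite scaler_eq0.
  case/orP => [/eqP yC0|/eqP //]; case/negP: yC.
  by rewrite [y *m C]mx11_scalar yC0 raddf0.
have imC m (h : 'M_(1, m)) M : N *m M = C *m h -> h = 0.
  by move=> e; apply: y0; rewrite -mulmxA -e mulmxA yN mul0mx.
have rPN : \rank (P *m N) = \rank N.
  apply/eqP; rewrite eqn_leq mxrankM_maxr /=; apply: mxrankS; rewrite submxE.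
  apply/eqP; have e : P *m (N *m cokermx (P *m N)) = 0 by rewrite mulmxA mulmx_coker.
  by rewrite (split_image sC e) (imC _ _ _ (split_image sC e)) mulmx0.
apply: (step sX sC Nx); apply: IH; split.
- by rewrite (rank_quot _ sX Nx) rPN.
- exact: dimD sX.
- move=> w' /mem_quotP [w [wD cw ->]] /= QBJ.
  have QB : Q *m w.1 = 0 by rewrite -(quot_QBJP sC cw) QBJ mul0mx.
  by rewrite (Dx w (u *m w.1) wD (split_kernel sX QB)) /= !(mulmx0, mul0mx) mxtrace0 subrr.
rewrite (rank_quot _ sX Nx) rPN.
have le : (left_null (P *m N *m L) (quot u Q C J D) <= quot u Q C J (left_null N D))%VS.
  apply/subvP => w'; rewrite mem_left_null => /andP [/mem_quotP [w [wD cw ->]]] /= /eqP.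
  move=> /(quot_left_eq0 sX sC Nx cw) [h NB]; apply/mem_quotP; exists w; split=> //.
  by rewrite mem_left_null wD NB (imC _ _ _ NB) mulmx0 eqxx.
have {le} := dimvS le.
case: cutC => [D00|[w wD0 cw]].
  have := dim_quot_le u Q C J (left_null N D); rewrite D00 dimv0; lia.
have : (\dim (quot u Q C J (left_null N D)) < \dim (left_null N D))%N.
  apply: (dim_quot_cut _ _ wD0); apply: contraNneq cw => cw.
  by apply/eqP; rewrite -[u *m _ *m C]mulmxA; apply: (split_kernel sX); rewrite mulmxA.
lia.
Qed.

(** Since [left_null N D] is smaller than the kernel, [rank1_span] gives a kernel
    vector [x] which is not the column space of any constraint; then every [C] is
    compatible with the prescribed values, and [C] can be chosen outside the image of
    [N] so as to lose a constraint of [left_null N D] if there is one.  The induction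
    stops in corank one, where [left_null N D] has become trivial. *)
Lemma solvable_small_left_null n (N : 'M[K]_n.+1) (D : constraints n.+1 n.+1) :
  small_left_null N D -> solvable N D.
Proof.
elim: n => [|n IH] in N D * => -[rN dD Dc dD0].
  by apply: solvable_independent;
    [apply/eqP; rewrite -leqn0 | | move=> w wD _; apply/eqP; rewrite -memv0;
     move: dD wD; rewrite /= leqn0 dimv_eq0 => /eqP -> ].
have D_eq0 : \dim D = 0%N -> forall w, w \in D -> w = 0.
  by move=> /eqP; rewrite dimv_eq0 => /eqP -> w; rewrite memv0 => /eqP.
have [rNn|rNn] := leqP n.+1 (\rank N).
  have rN' : \rank N = n.+1 by apply/eqP; rewrite eqn_leq rN.
  have [/D_eq0 D0|Dn0] := eqVneq (\dim D) 0%N.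
    by apply: solvable_independent => //; [move: dD => /=; lia | move=> w /D0].
  apply: solvable_corank1 => //; [by move: dD => /=; lia | | by left; move: dD Dn0 => /=; lia].
  move=> w wD NB; have : w \in left_null N D by rewrite mem_left_null wD NB eqxx.
  have /eqP : \dim (left_null N D) = 0%N by lia.
  by rewrite dimv_eq0 => /eqP ->; rewrite memv0 => /eqP.
have [|F FE] := @linfunP K _ _ (fun w : ('M[K]_n.+2 * K^o)%type => w.1).
  by move=> a v v'.
have [X dX XP] := rank1_span (F @: left_null N D).
have [|G GE] := @linfunP K _ _ (fun z : 'cV[K]_n.+2 => N *m z).
  by move=> a v v'; rewrite mulmxDr -scalemxAr.
have /subvPn [x xN xX] : ~~ (lker G <= X)%VS.
  apply/negP => /dimvS; rewrite (dim_lker_mulmx GE) leqNgt => /negP; apply.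
  apply: leq_ltn_trans dX _; apply: (@leq_ltn_trans (\dim (left_null N D))).
    by rewrite -[leqRHS](limg_ker_dim F) leq_addl.
  by move: dD0 rN rNn; lia.
have Nx : N *m x = 0 by move: xN; rewrite memv_ker GE => /eqP.
have [|u ux] := @left_inverse_col K _ x.
  by apply: contraNneq xX => ->; rewrite mem0v.
have Dx w h : w \in D -> w.1 = x *m h -> w = 0.
  move=> wD wE; apply: Dc => //; rewrite wE.
  suff /eqP -> : h == 0 by rewrite mulmx0.
  apply: contraNT xX => h0; apply: (XP _ h) => //; rewrite -wE -FE memv_img //.
  by rewrite mem_left_null wD wE mulmxA Nx mul0mx eqxx.
have [|y' [v [yN vy]]] := @kernel_vector _ _ _ N^T; first by rewrite mxrank_tr ltnW.
pose y := y'^T; have {}yN : y *m N = 0 by rewrite -[N]trmxK -trmx_mul yN trmx0.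
have y0 : y != 0.
  by apply/eqP => e; have := congr1 trmx vy; rewrite trmx_mul -/y e mul0mx trmx1 => /eqP;
     rewrite eq_sym oner_eq0.
have neq0 w : w \in D -> w != 0 -> w.1 - x *m (u *m w.1) != 0.
  by move=> wD; apply: contraNneq => /eqP; rewrite subr_eq0 => /eqP /(Dx w _ wD) ->.
have [C [yC cutD0 cutD]] : exists C : 'cV_n.+2, [/\ y *m C != 0,
    left_null N D = 0%VS \/
      (exists2 w, w \in left_null N D & w.1 *m C != x *m (u *m w.1 *m C)) &
    D = 0%VS \/ (exists2 w, w \in D & w.1 *m C != x *m (u *m w.1 *m C))].
  have cutE' w C : ((w.1 - x *m (u *m w.1)) *m C != 0) = (w.1 *m C != x *m (u *m w.1 *m C)).
    by rewrite mulmxBl subr_eq0 !mulmxA.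
  have [D00|D00] := eqVneq (left_null N D) 0%VS; last first.
    have wD0 := memv_pick (left_null N D); have wD := subvP (capvSl _ _) _ wD0.
    have [|C [yC cC]] := @avoid_kernels _ _ _ y _ y0 (neq0 _ wD _); rewrite ?vpick0 //.
    by exists C; split=> //; right; exists (vpick (left_null N D)); rewrite -?cutE'.
  have [D_0|Dn0] := eqVneq D 0%VS.
    have [C yC] := avoid_kernel y0.
    by exists C; split=> //; left.
  have [|C [yC cC]] := @avoid_kernels _ _ _ y _ y0 (neq0 _ (memv_pick D) _); rewrite ?vpick0 //.
  by exists C; split=> //; [left | right; exists (vpick D); rewrite -?cutE' ?memv_pick].
apply: (small_left_null_step IH _ dD0 Nx ux Dx yN yC cutD0) => // L Q J sX.
case: cutD => [D_0|[w wD cw]].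
  by apply: leq_trans (dim_quot_le _ _ _ _ _) _; rewrite D_0 dimv0.
have : (\dim (quot u Q C J D) < \dim D)%N.
  apply: (dim_quot_cut _ _ wD); apply: contraNneq cw => cw.
  by apply/eqP; rewrite -[u *m _ *m C]mulmxA; apply: (split_kernel sX); rewrite mulmxA.
by move: dD => /=; lia.
Qed.

End Affine.

(** * Linear problems *)

Section Linear.
Variable K : fieldType.
Notation constraints p n := {vspace ('M[K]_(p, n) * K^o)%type}.

Definition homogeneous p n (D : constraints p n) : Prop := forall w, w \in D -> w.2 = 0.

Lemma homogeneous_consistent p n (D : constraints p n) : homogeneous D -> consistent D.
Proof. by move=> D2 w wD w1; rewrite [w]surjective_pairing w1 D2. Qed.

Definition linear_problem n (N : 'M[K]_n.+1) (D : constraints n.+1 n.+1) : Prop :=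
  [/\ \rank N <= n, homogeneous D & \dim D <= n.-1]%N.

Definition linear_solvable n : Prop :=
  forall N D, @linear_problem n N D -> solvable N D.

(** The last alternative lists the reasons why the dimension bound is inherited.  In
    the last one the constraint [x *m h] becomes trivial in the quotient. *)
Lemma linear_step n (N : 'M[K]_n.+2) (D : constraints n.+2 n.+2)
    (x C : 'cV_n.+2) (u : 'rV_n.+2) :
  linear_solvable n -> linear_problem N D ->
  N *m x = 0 -> u *m x = 1%:M -> C != 0 -> (forall w, w \in D -> u *m w.1 *m C = 0) ->
  (\rank N <= n)%N \/ (exists z, C = N *m z) ->
  [\/ (\dim D <= n.-1)%N, exists2 w, w \in D & w.1 *m C != 0 |
     exists w h, [/\ w \in D, w != 0 & w.1 = x *m h]] ->
  solvable N D.
Proof.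
move=> IH [rN D2 dD] Nx ux C0 uC rankC dropD.
have [Cp CpC] := left_inverse_col C0.
have [L [Q sX]] := @splitting_exists K n.+2 1 n.+1 x u (erefl _) ux.
have [J [P sC]] := @splitting_exists K n.+2 1 n.+1 C Cp (erefl _) CpC.
apply: (step sX sC Nx); apply: IH; split.
- rewrite (rank_quot _ sX Nx); case: rankC => [rNn|[z zC]].
    exact: leq_trans (mxrankM_maxr _ _) rNn.
  rewrite -ltnS; apply: leq_trans rN; apply: (@rank_mulmx_lt _ _ _ _ _ _ z).
    by rewrite -zC.
  by rewrite -zC (splitting_pc sC).
- by move=> w' /mem_quotP [w [wD _ ->]] /=; rewrite D2 // uC // mxtrace0 subr0.
case: dropD => [dDn|[w wD wC]|[w [h [wD w0 wE]]]].
- exact: leq_trans (dim_quot_le _ _ _ _ _) dDn.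
- have : (\dim (quot u Q C J D) < \dim D)%N.
    apply: (dim_quot_cut _ _ wD); apply: contraNneq wC => e.
    have e' : Q *m (w.1 *m C) = 0 by rewrite mulmxA.
    by rewrite (split_kernel sX e') (mulmxA u) uC // mulmx0.
  by move: dD => /=; lia.
have lineD : (<[w]> <= D)%VS by rewrite -memvE.
have : (\dim (quot u Q C J D) + \dim <[w]>%VS <= \dim D)%N.
  apply: dim_quot_ker => // v vw; rewrite D2 ?uC ?(subvP lineD) // mxtrace0.
  have -> : Q *m v.1 = 0.
    have /vlineP [k ->] := vw.
    by rewrite /= wE -scalemxAr mulmxA (splitting_pc sX) mul0mx scaler0.
  by rewrite !mul0mx.
by rewrite dim_vline w0 /=; move: dD => /=; lia.
Qed.

(** In corank one [C] has to lie in the image of [N] for the quotient problem to be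
    singular again. *)
Lemma image_direction n (N : 'M[K]_n.+2) (D : constraints n.+2 n.+2) (u : 'rV_n.+2) :
  (\rank N <= n.+1)%N -> (\dim D <= n)%N ->
  exists C : 'cV_n.+2, [/\ C != 0, forall w, w \in D -> u *m w.1 *m C = 0 &
     (\rank N <= n)%N \/ (exists z, C = N *m z)].
Proof.
move=> rN dD; pose t : 'Hom(('M[K]_n.+2 * K^o)%type, K^o) := 0.
have t0 w : t w = 0 by rewrite zero_lfunE.
have [rNn|rNn] := leqP (\rank N) n.
  have [||C [C0 CE]] := @affine_avoid K _ n.+2 D (cut u 1%:M) t 0%VS.
  - by move=> w _ _; apply: t0.
  - by rewrite dimv0 ltnS ltnW // ltnS.
  exists C; split=> [|w wD|]; [by rewrite -memv0 | | by left].
  by rewrite -[u *m w.1]mulmx1 -cutE CE // t0 raddf0.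
have [|F FE] := @linfunP K _ _ (fun z : 'cV[K]_n.+2 => N *m z).
  by move=> a z z'; rewrite mulmxDr -scalemxAr.
have [||z [z0 zE]] := @affine_avoid K _ n.+2 D (cut u N) t (lker F).
- by move=> w _ _; apply: t0.
- by rewrite (dim_lker_mulmx FE); move: dD rNn; lia.
exists (N *m z); split=> [|w wD|]; [by rewrite -FE -memv_ker | | by right; exists z].
by rewrite mulmxA -cutE zE // t0 raddf0.
Qed.

Lemma linear_step_left n (N : 'M[K]_n.+2) (D : constraints n.+2 n.+2) :
  linear_solvable n -> linear_problem N D ->
  (\dim D <= n.-1)%N \/ (exists (x : 'cV_n.+2) (h : 'rV_n.+2) w,
    [/\ N *m x = 0, w \in D, w != 0 & w.1 = x *m h]) ->
  solvable N D.
Proof.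
move=> IH pND; have [rN D2 dD] := pND; case=> [dDn|[x [h [w [Nx wD w0 wE]]]]].
  have [|x [u [Nx ux]]] := @kernel_vector _ _ _ N; first by rewrite ltnS.
  have [C [C0 uC rC]] := image_direction u rN dD.
  by apply: (linear_step IH pND Nx ux C0 uC rC); constructor 1.
have [u ux] : exists u : 'rV_n.+2, u *m x = 1%:M.
  apply: left_inverse_col; apply: contraNneq w0 => x0.
  by apply/eqP/(homogeneous_consistent D2) => //; rewrite wE x0 mul0mx.
have [C [C0 uC rC]] := image_direction u rN dD.
by apply: (linear_step IH pND Nx ux C0 uC rC); constructor 3; exists w, h.
Qed.

Lemma transpose_linear_problem n (N : 'M[K]_n.+1) D D' : linear_problem N D ->
  (\dim D' <= \dim D)%N -> (forall w, (w \in D') = (tr_constraint w \in D)) ->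
  linear_problem N^T D'.
Proof.
move=> [rN D2 dD] dD' D'P; split; rewrite ?mxrank_tr ?(leq_trans dD') //.
by move=> w; rewrite D'P => /D2.
Qed.

(** What is left when no step of [linear_step_left], transposed or not, applies. *)
Definition irreducible_problem n (N : 'M[K]_n.+2) (D : constraints n.+2 n.+2) : Prop :=
  [/\ (n <= \dim D)%N, (0 < n)%N,
      forall (x : 'cV_n.+2) (h : 'rV_n.+2) w, N *m x = 0 -> w \in D -> w.1 = x *m h -> w = 0 &
      forall (c : 'cV_n.+2) (y : 'rV_n.+2) w, y *m N = 0 -> w \in D -> w.1 = c *m y -> w = 0].

Lemma solvable_or_irreducible n (N : 'M[K]_n.+2) (D : constraints n.+2 n.+2) :
  linear_solvable n -> linear_problem N D -> solvable N D \/ irreducible_problem N D.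
Proof.
move=> IH pND; have [//|nsol] := classic (solvable N D); [by left | right].
have dD : (n.-1 < \dim D)%N.
  by rewrite ltnNge; apply/negP => dD; apply: nsol; apply: linear_step_left => //; left.
have n0 : (0 < n)%N by case: pND => _ _; move: dD; lia.
split=> //; first by move: dD n0; lia.
  move=> x h w Nx wD wE; apply/eqP/negPn/negP => w0; apply: nsol.
  by apply: linear_step_left => //; right; exists x, h, w.
move=> c y w yN wD wE; apply/eqP/negPn/negP => w0; apply: nsol.
have [D' dD' D'P] := transpose_constraints D.
apply: (@solvable_transpose _ _ _ _ D').
  by move=> v vD; rewrite D'P /tr_constraint /= trmxK -surjective_pairing.
apply: linear_step_left => //; first exact: transpose_linear_problem dD' D'P.
right; exists y^T, c^T, (tr_constraint w); split.
- by rewrite -trmx_mul yN trmx0.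
- by rewrite D'P /tr_constraint /= trmxK -surjective_pairing.
- apply: contraNneq w0 => -[w1 w2].
  by rewrite [w]surjective_pairing -[w.1]trmxK w1 w2 trmx0.
- by rewrite /= wE trmx_mul.
Qed.

(** In corank one, irreducibility makes a constraint [B] determined by [N B], and also
    by [B N]. *)
Lemma irreducible_corank1 n (N : 'M[K]_n.+2) (D : constraints n.+2 n.+2) :
  linear_problem N D -> irreducible_problem N D -> \rank N = n.+1 -> solvable N D.
Proof.
move=> [_ D2 dD] [dD' n0 Dx Dy] rN.
have [|x [u [Nx ux]]] := @kernel_vector _ _ _ N; first by rewrite rN.
have [|y [v [yN yv]]] := @coker_vector _ _ _ N; first by rewrite rN.
have DN w : w \in D -> N *m w.1 = 0 -> w = 0.
  by move=> wD /(kernel_line rN Nx ux); apply: Dx.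
have DN' w : w \in D -> w.1 *m N = 0 -> w = 0.
  by move=> wD /(cokernel_line rN yN yv); apply: Dy.
have [[w wD NBN]|NBN] := classic (exists2 w, w \in D & N *m w.1 *m N != 0).
  by apply: solvable_corank1 => //; right; exists w.
apply: (@solvable_square_zero _ _ _ _ (vpick D)) => //; rewrite ?memv_pick //.
  by move=> w wD; apply/eqP/negPn/negP => h; apply: NBN; exists w.
by rewrite vpick0 -dimv_eq0; move: dD' n0; lia.
Qed.

(** What is left when no homogeneous step loses a constraint, for the problem and for
    its transpose. *)
Definition degenerate n (N : 'M[K]_n.+2) (D : constraints n.+2 n.+2) : Prop :=
  (forall (x C : 'cV_n.+2) (u : 'rV_n.+2), N *m x = 0 -> u *m x = 1%:M ->
    (forall w, w \in D -> u *m w.1 *m C = 0) -> forall w, w \in D -> w.1 *m C = 0) /\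
  (forall (v : 'cV_n.+2) (y R : 'rV_n.+2), y *m N = 0 -> y *m v = 1%:M ->
    (forall w, w \in D -> R *m w.1 *m v = 0) -> forall w, w \in D -> R *m w.1 = 0).

Lemma solvable_or_degenerate n (N : 'M[K]_n.+2) (D : constraints n.+2 n.+2) :
  linear_solvable n -> linear_problem N D -> (\rank N <= n)%N ->
  solvable N D \/ degenerate N D.
Proof.
move=> IH pND rN; have [//|nsol] := classic (solvable N D); [by left | right].
split=> [x C u Nx ux uC w wD|v y R yN yv Rv w wD]; apply/eqP/negPn/negP => w0; apply: nsol.
  have C0 : C != 0 by apply: contraNneq w0 => ->; rewrite mulmx0.
  by apply: (linear_step IH pND Nx ux C0 uC); [left | constructor 2; exists w].
have [D' dD' D'P] := transpose_constraints D.
apply: (@solvable_transpose _ _ _ _ D').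
  by move=> w' wD'; rewrite D'P /tr_constraint /= trmxK -surjective_pairing.
apply: (@linear_step _ _ _ y^T R^T v^T) => //.
- exact: transpose_linear_problem dD' D'P.
- by rewrite -trmx_mul yN trmx0.
- by rewrite -trmx_mul yv trmx1.
- by apply: contraNneq w0 => /(congr1 trmx); rewrite trmxK trmx0 => ->; rewrite mul0mx.
- move=> w'; rewrite D'P => /Rv /= e.
  by apply: trmx_inj; rewrite trmx0 !trmx_mul !trmxK mulmxA.
- by left; rewrite mxrank_tr.
constructor 2; exists (tr_constraint w).
  by rewrite D'P /tr_constraint /= trmxK -surjective_pairing.
apply: contraNneq w0 => /(congr1 trmx); rewrite /= !trmx_mul !trmxK trmx0 => ->.
by [].
Qed.

Lemma image_test n p (N : 'M[K]_(n, p)) (C : 'cV_n) :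
  (forall y : 'rV_n, y *m N = 0 -> y *m C = 0) -> exists z, C = N *m z.
Proof.
move=> H; have : (C^T <= N^T)%MS.
  rewrite submxE -[cokermx _]trmxK -trmx_mul; apply/eqP.
  set M := (cokermx N^T)^T; suff -> : M *m C = 0 by rewrite trmx0.
  apply/row_matrixP => i; rewrite row_mul row0; apply: H; rewrite -row_mul.
  suff -> : M *m N = 0 by rewrite row0.
  by apply: trmx_inj; rewrite trmx_mul trmxK mulmx_coker trmx0.
by case/submxP => R CE; exists R^T; apply: trmx_inj; rewrite trmx_mul trmxK.
Qed.

Lemma irreducible_nonzero n (N : 'M[K]_n.+2) (D : constraints n.+2 n.+2) :
  linear_problem N D -> irreducible_problem N D -> exists2 w, w \in D & w.1 != 0.
Proof.
move=> [_ D2 _] [dD n0 _ _]; exists (vpick D); first exact: memv_pick.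
apply/eqP => /(homogeneous_consistent D2 (memv_pick D))/eqP.
by rewrite vpick0 -dimv_eq0; move: dD n0; lia.
Qed.

(** The [C] provided by [image_direction] is killed by all constraints.  If it were
    outside the image of [N], the transposed half of degeneracy would apply to
    [v = C] with any [R] and kill everything. *)
Lemma degenerate_common_kernel n (N : 'M[K]_n.+2) (D : constraints n.+2 n.+2) :
  linear_problem N D -> irreducible_problem N D -> degenerate N D ->
  exists z : 'cV_n.+2, N *m z != 0 /\ forall w, w \in D -> w.1 *m (N *m z) = 0.
Proof.
move=> pND iND [dl dr]; have [rN D2 dD] := pND.
have [w0 w0D w00] := irreducible_nonzero pND iND.
have [|x [u [Nx ux]]] := @kernel_vector _ _ _ N; first by rewrite ltnS.
have [C [C0 uC _]] := image_direction u rN dD.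
have DC := dl x C u Nx ux uC.
have [|z zC] := @image_test _ _ N C.
  move=> y yN; apply/eqP/negPn/negP => yC0; case/eqP: w00.
  have y0 : (y *m C) 0 0 != 0.
    by apply: contraNneq yC0 => e; rewrite [y *m C]mx11_scalar e raddf0.
  apply/row_matrixP => i; rewrite row0 rowE.
  apply: (dr (((y *m C) 0 0)^-1 *: C) y) => //.
    by rewrite -scalemxAr [y *m C]mx11_scalar scale_scalar_mx mxE eqxx mulVf.
  by move=> w wD; rewrite -scalemxAr -mulmxA DC // mulmx0 scaler0.
by exists z; rewrite -zC.
Qed.

(** Let [V] be the space of all [B *m C], for [C] outside the image of [N].
    Degeneracy forces [V] to contain the images of all constraints and the kernel of
    [N].  If the step loses at most one constraint, then [\dim V <= 2], so [V] equals
    the kernel of [N]; now every constraint is in [left_null N D], which is then too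
    large. *)
Lemma degenerate_small_left_null n (N : 'M[K]_n.+2) (D : constraints n.+2 n.+2) :
  linear_problem N D -> irreducible_problem N D -> degenerate N D -> (\rank N <= n)%N ->
  (\dim (left_null N D) + \rank N <= n.+1)%N -> solvable N D.
Proof.
move=> pND iND [dl dr] rNn dD0; have [rN D2 dD] := pND; have [dDn n0 Dx _] := iND.
have [w0 w0D w00] := irreducible_nonzero pND iND.
have [|x [u [Nx ux]]] := @kernel_vector _ _ _ N; first by rewrite ltnS.
have [|y [v [yN yv]]] := @coker_vector _ _ _ N; first by rewrite ltnS.
have y0 : y != 0.
  by apply/eqP => e; move: yv; rewrite e mul0mx => /eqP; rewrite eq_sym oner_eq0.
have [C [yC cutD0]] : exists C : 'cV_n.+2, y *m C != 0 /\
   (left_null N D = 0%VS \/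
      exists2 w, w \in left_null N D & w.1 *m C != x *m (u *m w.1 *m C)).
  have [D00|D00] := eqVneq (left_null N D) 0%VS.
    by have [C yC] := avoid_kernel y0; exists C; split=> //; left.
  pose w := vpick (left_null N D); have wD0 : w \in left_null N D := memv_pick _.
  have wx : w.1 - x *m (u *m w.1) != 0.
    apply: contraNneq D00 => /eqP; rewrite subr_eq0 => /eqP e; rewrite -vpick0; apply/eqP.
    by apply: (Dx x (u *m w.1)) => //; apply: (subvP (capvSl _ _) _ wD0).
  have [C [yC wC]] := avoid_kernels y0 wx; exists C; split=> //; right; exists w => //.
  by move: wC; rewrite mulmxBl subr_eq0 !mulmxA.
apply: (small_left_null_step (@solvable_small_left_null K n) rNn dD0 Nx ux _ yN yC cutD0).
  by move=> w h; apply: Dx.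
move=> L Q J sX.
(* the space of all [B *m C]; rescaling [C] makes [y *m C = 1] without changing it *)
pose V := (cut 1%:M C @: D)%VS.
have yC0 : (y *m C) 0 0 != 0.
  by apply: contraNneq yC => e; rewrite [y *m C]mx11_scalar e raddf0.
have RV (R : 'rV_n.+2) : (forall b, b \in V -> R *m b = 0) ->
    forall w, w \in D -> R *m w.1 = 0.
  move=> H; apply: (dr (((y *m C) 0 0)^-1 *: C) y) => //.
    by rewrite -scalemxAr [y *m C]mx11_scalar scale_scalar_mx mxE eqxx mulVf.
  move=> w wD; rewrite -scalemxAr -mulmxA H ?scaler0 //.
  by rewrite -[w.1]mul1mx -cutE memv_img.
have imV w z : w \in D -> w.1 *m z \in V.
  move=> wD; apply/negPn/negP => /separate [R [/RV RD]].
  by rewrite mulmxA RD // mul0mx => /eqP; rewrite eq_sym oner_eq0.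
have [|F FE] := @linfunP K _ _ (fun z : 'cV[K]_n.+2 => N *m z).
  by move=> a z z'; rewrite mulmxDr -scalemxAr.
have kerV : (lker F <= V)%VS.
  apply/subvP => x'; rewrite memv_ker FE => /eqP Nx'; apply/negPn/negP.
  move=> /separate [R [/RV RD Rx']]; have [z w0z] := avoid_kernel w00.
  case/negP: w0z; apply/eqP; apply: (dl x' z R) => // w wD.
  by rewrite RD // mul0mx.
rewrite leqNgt; apply/negP => dq.
have dcut : (\dim (cut Q C @: D) <= 1)%N.
  by have := dim_quot u Q C J D; move: dq dD n0 => /=; lia.
have [|H HE] := @linfunP K _ _ (fun z : 'cV[K]_n.+2 => Q *m z).
  by move=> a z z'; rewrite mulmxDr -scalemxAr.
have dV : (\dim V <= 2)%N.
  rewrite -(limg_ker_dim H V) -[2%N]/(1 + 1)%N leq_add //.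
    apply: (@leq_trans (\dim <[x]>%VS)); last by rewrite dim_vline leq_b1.
    apply/dimvS/subvP => z; rewrite memv_cap memv_ker HE => /andP [_ /eqP Qz].
    rewrite (split_kernel sX Qz) [u *m z]mx11_scalar mul_mx_scalar.
    exact/memvZ/memv_line.
  apply: leq_trans dcut; apply/dimvS/subvP => _ /memv_imgP [_ /memv_imgP [w wD ->] ->].
  by rewrite HE cutE mul1mx mulmxA -cutE memv_img.
have dF := dim_lker_mulmx FE.
have VE : V = lker F.
  by apply/eqP; rewrite eq_sym eqEdim kerV dF; move: dV rNn; lia.
have : (\dim V <= \dim (left_null N D))%N.
  have -> : left_null N D = D.
    apply/vspaceP => w; rewrite mem_left_null; apply: andb_idr => wD.
    apply/negPn/negP => /avoid_kernel [z]; rewrite -mulmxA -FE.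
    by have := imV w z wD; rewrite VE memv_ker => ->.
  by rewrite -[leqRHS](limg_ker_dim (cut 1%:M C)) leq_addl.
by rewrite VE dF; move: dD0; lia.
Qed.

(** Fix [A] on the whole kernel [X] of [N], with a first column [c] in the image of [N]
    and killed by all constraints, so that the map induced by [N] stays singular.
    The other columns need to be independent modulo [c] and to make the step
    homogeneous: this is a problem with zero [N], of size [n.+1] by [s].  All of
    [left_null N D] becomes trivial in the quotient, which compensates for the
    decrease of the size. *)
Lemma degenerate_large_left_null n (N : 'M[K]_n.+2) (D : constraints n.+2 n.+2) :
  (forall m, (m <= n)%N -> linear_solvable m) ->
  linear_problem N D -> irreducible_problem N D -> degenerate N D ->
  (n.+1 < \dim (left_null N D) + \rank N)%N -> solvable N D.
Proof.
move=> IH pND iND dND dD0; have [rN D2 dD] := pND.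
have [/eqP rN0|rN0] := posnP (\rank N).
  move: rN0; rewrite mxrank_eq0 => /eqP ->; apply: solvable_flanders => //.
    by move: dD => /=; lia.
  exact: homogeneous_consistent.
have [z [Nz DNz]] := degenerate_common_kernel pND iND dND.
have [c cE] : exists c, c = N *m z by exists (N *m z).
rewrite -cE in Nz DNz.
have [r rE] : exists r, \rank N = r.+1 by exists (\rank N).-1; rewrite prednK.
have [X [rX NX kX]] := kernel_basis N.
have [s sE] : exists s, (n.+2 - \rank N)%N = s.+1.
  by exists (n.+1 - \rank N)%N; rewrite subSn.
move: X rX NX kX; rewrite sE => X rX NX kX.
have [Xp XpX] := full_rank_left_inverse rX.
pose u := usubmx (Xp : 'M_(1 + s, n.+2)); pose Xp2 := dsubmx (Xp : 'M_(1 + s, n.+2)).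
have XpE : Xp = col_mx u Xp2 by rewrite vsubmxK.
have [Cp CpC] := left_inverse_col Nz.
have [J0 [P0 sC0]] := @splitting_exists K n.+2 1 n.+1 c Cp (erefl _) CpC.
(* the constraints on [G] that make [tr (Xp *m B *m C)] vanish for [C = row_mx c (J0 *m G)];
   the first column [c] does not contribute *)
pose phi := shrink (0 : 'rV_n.+2) Xp2 (0 : 'cV_n.+2) J0.
have phiE w : phi w = (Xp2 *m w.1 *m J0, w.2).
  by rewrite shrinkE !mul0mx mxtrace0 subr0.
have [|||G [GD rG]] := @solvable_flanders K n.+1 s (phi @: D)%VS.
- by move: sE rN0; lia.
- apply: leq_trans (dD); rewrite /= -[leqRHS](limg_ker_dim phi) leq_addl //.
- move=> _ /memv_imgP [w wD ->]; rewrite phiE /= => ->.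
  by rewrite D2.
have {}rG : \rank G = s by rewrite -[RHS](rG 0) scaler0 addr0.
pose C : 'M_(n.+2, 1 + s) := row_mx c (J0 *m G).
have rC : \rank C = s.+1.
  apply: (@col_inj_rank _ _ (1 + s)) => v; rewrite -[v]vsubmxK mul_row_col => Cv.
  have Gv : dsubmx v = 0.
    apply: (rank_col_inj rG); have := congr1 (mulmx P0) Cv.
    by rewrite mulmxDr !mulmxA (splitting_pc sC0) (splitting_pj sC0) mul0mx add0r mul1mx mulmx0.
  move: Cv; rewrite Gv mulmx0 addr0 => Cv; have := congr1 (mulmx Cp) Cv.
  by rewrite mulmxA CpC mul1mx mulmx0 => ->; rewrite col_mx0.
have [Cp' CpC'] := full_rank_left_inverse rC.
have nE : n.+2 = (s.+1 + r.+1)%N by rewrite -sE -rE subnK // ltnW.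
have [L [Q sX]] := splitting_exists nE XpX.
have [J [P sC]] := splitting_exists nE CpC'.
have trC w : w \in D -> \tr (Xp *m w.1 *m C) = 0.
  move=> wD; transitivity (\tr (block_mx (u *m w.1 *m c) (u *m w.1 *m (J0 *m G))
      (Xp2 *m w.1 *m c) (Xp2 *m w.1 *m (J0 *m G)))).
    by rewrite -mul_col_row -mul_col_mx -XpE.
  rewrite mxtrace_block.
  rewrite -mulmxA DNz // mulmx0 mxtrace0 add0r mulmxA.
  by have := GD (phi w) (memv_img _ wD); rewrite phiE /= D2.
apply: (step sX sC NX); apply: IH.
  by move: dD rN; lia.
split.
- rewrite (rank_quot _ sX NX) -ltnS; apply: leq_trans (eq_leq rE).
  apply: (@rank_mulmx_lt _ _ _ _ _ _ z); first by rewrite -cE.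
  rewrite -cE; have : P *m row_mx c (J0 *m G) = row_mx 0 0.
    by rewrite row_mx0; apply: (splitting_pc sC).
  by rewrite mul_mx_row => /eq_row_mx [].
- by move=> w' /mem_quotP [w [wD _ ->]] /=; rewrite D2 // trC // subr0.
have : (\dim (quot Xp Q C J D) + \dim (left_null N D) <= \dim D)%N.
  apply: dim_quot_ker => [|w]; first exact: capvSl.
  rewrite mem_left_null => /andP [wD /eqP NB]; rewrite D2 // trC //.
  have [Y ->] := kX _ _ NB.
  by rewrite mulmxA (splitting_pc sX) !mul0mx.
by move: dD dD0 rE rN => /=; lia.
Qed.

Lemma linear_solvable_all n : linear_solvable n.
Proof.
have [m] := ubnP n; elim: m n => // m IH n; rewrite ltnS => nm.
case: n => [|n] in nm *; move=> N D pND; have [rN D2 dD] := pND.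
  have /eqP -> : N == 0 by rewrite -mxrank_eq0 -leqn0.
  by apply: solvable_flanders => //; apply: homogeneous_consistent.
have IHn k : (k <= n)%N -> linear_solvable k.
  by move=> kn; apply: IH; apply: leq_ltn_trans kn nm.
have [//|iND] := solvable_or_irreducible (IHn n (leqnn n)) pND.
have [rNn|rNn] := leqP (\rank N) n; last first.
  by apply: irreducible_corank1 => //; apply/eqP; rewrite eqn_leq rN.
have [//|dND] := solvable_or_degenerate (IHn n (leqnn n)) pND rNn.
have [dD0|dD0] := leqP (\dim (left_null N D) + \rank N) n.+1.
  exact: degenerate_small_left_null.
exact: degenerate_large_left_null.
Qed.

(** Deleting a row: the constraints that do not kill [C] are absorbed by the entries of
    [A] along [C]. *)
Lemma rect_step n p (N : 'M[K]_(n, p)) (D : constraints p n) (C : 'cV_n) Cp m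
    (J : 'M[K]_(n, m)) P :
  splitting C Cp J P ->
  solvable (P *m N) (quot (0 : 'M_(1, p)) 1%:M C J D) -> solvable N D.
Proof.
move=> sC [A' [A'D rA']].
have [|w wD cw|R RE] := @factor_trace K p n p 1 1%:M C D
    (fun w => w.2 - \tr (1%:M *m w.1 *m J *m A')).
- move=> a u v /=; rewrite mulmxDr -scalemxAr !mulmxDl -!scalemxAl.
  rewrite mxtraceD mxtraceZ -![_ *: _]/(_ * _) mulrBr opprD.
  by rewrite addrACA.
- apply/eqP; rewrite subr_eq0 eq_sym; apply/eqP.
  rewrite (A'D (1%:M *m w.1 *m J, w.2)) //; apply/mem_quotP; exists w.
  by rewrite !mul0mx mxtrace0 subr0.
exists (C *m R + J *m A'); split=> [w wD|l].
  rewrite mulmxDr mxtraceD; have := RE w wD; rewrite !mul1mx => e.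
  rewrite mulmxA mxtrace_mulC e mulmxA subrK //.
apply: col_inj_rank => v Av; apply: (rank_col_inj (rA' l)).
have := congr1 (mulmx P) Av; rewrite mulmx0 mulmxA => <-.
congr (_ *m v); rewrite !mulmxDr !mulmxA (splitting_pc sC) (splitting_pj sC).
by rewrite mul0mx add0r mul1mx -scalemxAr.
Qed.

(** The bound [n - 2] leaves exactly enough constraints to lose one with each row
    deleted. *)
Lemma rect_solvable n p (N : 'M[K]_(n, p)) (D : constraints p n) :
  (2 <= p)%N -> (p <= n)%N -> (\rank N < p)%N -> homogeneous D -> (\dim D <= n - 2)%N ->
  solvable N D.
Proof.
move=> p2; elim: n => [|n IH] in N D *; first by case: p p2 N D => [|p].
rewrite leq_eqVlt => /orP [/eqP pE|pn] rN D2 dD.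
  subst p; apply: linear_solvable_all; split=> //.
  by move: dD; lia.
have [C [C0 cutC]] : exists C : 'cV_n.+1, C != 0 /\
    (D = 0%VS \/ exists2 w, w \in D & w.1 *m C != 0).
  have [->|Dn0] := eqVneq D 0%VS.
    exists (delta_mx 0 0); split; last by left.
    by apply/matrix0Pn; exists 0, 0; rewrite mxE !eqxx oner_eq0.
  have [|C wC] := @avoid_kernel K _ _ (vpick D).1.
    apply/eqP => /(homogeneous_consistent D2 (memv_pick D))/eqP.
    by rewrite vpick0 (negbTE Dn0).
  exists C; split; first by apply: contraNneq wC => ->; rewrite mulmx0.
  by right; exists (vpick D); rewrite ?memv_pick.
have [Cp CpC] := left_inverse_col C0.
have [J [P sC]] := @splitting_exists K n.+1 1 n C Cp (erefl _) CpC.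
apply: (rect_step sC); apply: IH => //.
- exact: leq_ltn_trans (mxrankM_maxr _ _) rN.
- by move=> w' /mem_quotP [w [wD _ ->]] /=; rewrite D2 // !mul0mx mxtrace0 subr0.
case: cutC => [D_0|[w wD wC]].
  by apply: leq_trans (dim_quot_le _ _ _ _ _) _; rewrite D_0 dimv0.
have : (\dim (quot (0 : 'M_(1, p)) 1%:M C J D) < \dim D)%N.
  by apply: (dim_quot_cut _ _ wD); rewrite mul1mx.
by move: dD pn p2; lia.
Qed.

Lemma annihilator n p (S : {vspace 'M[K]_(n, p)}) :
  exists D : constraints p n, [/\ homogeneous D, (\dim D <= codimv S)%N &
    forall A, (forall w, w \in D -> \tr (w.1 *m A) = w.2) -> A \in S].
Proof.
pose T := (S^C)%VS; pose q := daddv_pi T S; pose e := vbasis T.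
have q_lin i : scalar (fun A => coord e i (q A)).
  by move=> a A B; rewrite !linearP.
have /fin_all_exists [R RE] i := functional_trace (q_lin i).
pose r := [seq (R i, 0 : K^o) | i <- enum 'I_(\dim T)].
have mem_r i : (R i, 0 : K^o) \in r by apply/mapP; exists i; rewrite ?mem_enum.
have [|t tE] := @linfunP K _ K^o (fun w : ('M[K]_(p, n) * K^o)%type => w.2).
  by move=> a v v'.
exists <<r>>%VS; split=> [w wr||A AD].
- have /subvP/(_ w wr) : (<<r>> <= lker t)%VS.
    by apply/span_subvP => _ /mapP [i _ ->]; rewrite memv_ker tE.
  by rewrite memv_ker tE => /eqP.
- apply: leq_trans (dim_span _) _; rewrite size_map size_enum_ord dimv_compl.
  by rewrite /codimv.
have qA : q A = 0.
  rewrite (coord_vbasis (memv_pi T S A)) big1 // => i _.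
  by rewrite RE (AD (R i, 0)) ?scale0r // memv_span.
rewrite -[A](daddv_pi_add (capv_compl S)) ?addv_complf ?memvf //.
by rewrite -/T -/q qA addr0 memv_pi.
Qed.

End Linear.

Theorem theorem3 (K : fieldType) (n p : nat) (hp : (2 <= p)%N) (hnp : (p <= n)%N)
  (S : {vspace 'M[K]_(n, p)}) (hS : (codimv S <= n - 2)%N)
  (N : 'M[K]_(n, p)) (hN : (\rank N < p)%N) :
  exists A : 'M[K]_(n, p),
    A \in S /\ forall lambda : K, \rank (A + lambda *: N)%R = p.
Proof.
have [D [D2 dD DS]] := annihilator S.
have [A [AD rA]] := rect_solvable hp hnp hN D2 (leq_trans dD hS).
by exists A; split; first exact: DS.
Qed.
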